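(* For a root system $\Phi$ spanning a real Euclidean space $V$, let the projective configuration of $\Phi$ be the finite set $\{\mathbb{R}\alpha : \alpha \in \Phi\} \subset \mathbb{P}(V)$ of lines spanned by its roots, and denote it by the name of the type of $\Phi$ (so $F_4$, $E_6$, $E_7$, $E_8$, $H_3$, $H_4$ are configurations in Euclidean spaces of dimensions $4, 6, 7, 8, 3, 4$ respectively). Then: (1) The finite projective configurations $F_4$, $E_7$, $E_8$ and $H_4$ are saturated and non-colourable. (2) The configuration $H_3$ is saturated, but colourable. (3) The configuration $E_6$ admits an extension to a saturated finite configuration which is non-colourable; that is, there exists a finite set $B$ of lines in the 6-dimensional Euclidean space spanned by the $E_6$ root system such that $B$ contains all lines of the $E_6$ configuration, $B$ is saturated, and $B$ is non-colourable.
   Context: Let $\mathcal{H}$ be a real (or complex) inner product space of finite dimension $d$, let $\mathbb{P}(\mathcal{H})$ be the set of its one-dimensional subspaces (lines), with the orthogonality relation $\perp$ between lines, and let $A \subset \mathbb{P}(\mathcal{H})$ be a finite set (a ''finite projective configuration''). Colourability. A bicolouring $v : A \to \{0,1\}$ is good if (i) for every collection of $d$ mutually orthogonal lines $x_1, \dots, x_d \in A$ there is a unique $i_0$ with $v(x_{i_0}) = 1$; and (ii) for all $x, y \in A$, if $y \perp x$ and $v(x) = 1$, then $v(y) = 0$. $A$ is colourable if it admits a good bicolouring, and non-colourable otherwise. Saturation. $A$ is saturated if every set $U \subset A$ of pairwise orthogonal lines is contained in some set $M \subset A$ consisting of exactly $d$ pairwise orthogonal lines. Root systems (standard models; only the lines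 spanned by the roots matter, so scaling is irrelevant; $d$ is always the dimension of the span of the roots). Let $\tau = (1+\sqrt5)/2$. - $F_4$ in $\mathbb{R}^4$: $\pm e_i$; $\pm e_i \pm e_j$ ($i<j$); $\frac12(\pm1,\pm1,\pm1,\pm1)$ (48 roots, 24 lines). - $E_8$ in $\mathbb{R}^8$: $\pm e_i \pm e_j$ ($i<j$); $\frac12(\pm1,\dots,\pm1)$ with an even number of minus signs (240 roots, 120 lines). - $E_7$ in the 7-dimensional space $\{a \in \mathbb{R}^8 : \sum_i a_i = 0\}$: all coordinate permutations of $(1,-1,0,0,0,0,0,0)$ and of $\frac12(1,1,1,1,-1,-1,-1,-1)$ (126 roots, 63 lines). - $E_6$ in the 6-dimensional space $R = \{(x;y;z) : x,y,z \in \mathbb{R}^3,\ \sum_i x_i = \sum_i y_i = \sum_i z_i = 0\} \subset \mathbb{R}^9$: the vectors $(\xi;0;0)$, $(0;\xi;0)$, $(0;0;\xi)$ with $\xi \in \{(1,-1,0),(1,0,-1),(0,1,-1)\}$, the vectors $(\xi;\eta;\zeta)$ with $\xi,\eta,\zeta \in \{\frac13(2,-1,-1),\frac13(-1,2,-1),\frac13(-1,-1,2)\}$, and the negatives of all these (72 roots, 36 lines). - $H_4$ in $\mathbb{R}^4$: $\pm e_i$; $\frac12(\pm1,\pm1,\pm1,\pm1)$; all even coordinate permutations of $\frac12(\pm\tau,\pm1,\pm\tau^{-1},0)$ (120 roots, 60 lines). - $H_3$ in $\mathbb{R}^3$: up to scaling, $(\pm1,0,0)$, $(\pm1,\pm\tau^{-1},\pm\tau)$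 and all vectors obtained from these by cyclic permutations of coordinates (30 roots, 15 lines). *)

(* Defs.v *)
From mathcomp Require Import all_boot all_order all_algebra all_fingroup.
From mathcomp Require Import finmap.
From mathcomp Require Import reals.

Set Implicit Arguments.
Unset Strict Implicit.
Unset Printing Implicit Defensive.

Import Order.TTheory GRing.Theory Num.Theory.
Local Open Scope fset_scope.
Local Open Scope ring_scope.

(* A finite-dimensional Euclidean space is a subspace V of 'rV[R]_n carrying
   the standard inner product; its dimension d is \dim V. *)

Section Configurations.
Variables (R : realType) (n : nat).
Implicit Types (L M V : {vspace 'rV[R]_n}) (A B U : {fset {vspace 'rV[R]_n}}).

Definition dotp (u v : 'rV[R]_n) : R := \sum_(i < n) u 0 i * v 0 i.

Definition perp L M : Prop := {in L & M, forall u v, dotp u v = 0}.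

Definition projective_configuration V A : Prop :=
  forall L, L \in A -> (L <= V)%VS /\ \dim L = 1%N.

(* The colour of x is 1 when v x = true and 0 when v x = false. Mutually
   orthogonal lines are distinct, so a family indexed by 'I_d suffices. *)
Definition good_bicolouring V A (v : A -> bool) : Prop :=
  (forall x : 'I_(\dim V) -> A,
     (forall i j, i != j -> perp (val (x i)) (val (x j))) ->
     exists! i0, v (x i0) = true) /\
  (forall x y : A, perp (val y) (val x) -> v x = true -> v y = false).

Definition colourable V A : Prop :=
  exists v : A -> bool, good_bicolouring V v.

Definition pairwise_perp U : Prop :=
  {in U &, forall L M, L != M -> perp L M}.

Definition saturated V A : Prop :=
  forall U, U `<=` A -> pairwise_perp U ->
  exists M : {fset {vspace 'rV[R]_n}},
    [/\ U `<=` M, M `<=` A, #|` M| = \dim V & pairwise_perp M].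

Definition root_space (Phi : {fset 'rV[R]_n}) : {vspace 'rV[R]_n} := <<Phi>>%VS.

Definition root_lines (Phi : {fset 'rV[R]_n}) : {fset {vspace 'rV[R]_n}} :=
  [fset <[a]>%VS | a in Phi].

End Configurations.

Section RootSystems.
Variable R : realType.

Definition row_of n (s : seq R) : 'rV[R]_n := \row_(i < n) s`_i.

Definition unit_vec n (i : 'I_n) : 'rV[R]_n := delta_mx 0 i.

(* true stands for a minus sign. *)
Definition sgn (b : bool) : R := (-1) ^+ b.

Definition sign_change n (s : {ffun 'I_n -> bool}) (a : 'rV[R]_n) : 'rV[R]_n :=
  \row_i (sgn (s i) * a 0 i).

Definition roots_unit n : {fset 'rV[R]_n} :=
  [fset sgn b *: unit_vec i | b : bool, i : 'I_n].

Definition roots_pair n : {fset 'rV[R]_n} :=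
  [fset sgn s.1 *: unit_vec p.1 + sgn s.2 *: unit_vec p.2
    | s : (bool * bool)%type, p : ('I_n * 'I_n)%type & (p.1 < p.2)%N].

Definition roots_half n : {fset 'rV[R]_n} :=
  [fset sign_change s (const_mx (1 / 2)) | s : {ffun 'I_n -> bool}].

Definition F4 : {fset 'rV[R]_4} :=
  roots_unit 4 `|` roots_pair 4 `|` roots_half 4.

Definition E8 : {fset 'rV[R]_8} :=
  roots_pair 8 `|`
  [fset sign_change s (const_mx (1 / 2))
    | s : {ffun 'I_8 -> bool} & ~~ odd #|[set i | s i]|].

Definition permutations_of n (a : 'rV[R]_n) : {fset 'rV[R]_n} :=
  [fset col_perm p a | p : 'S_n].

Definition E7 : {fset 'rV[R]_8} :=
  permutations_of (row_of 8 [:: 1; -1; 0; 0; 0; 0; 0; 0]) `|`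
  permutations_of ((1 / 2) *: row_of 8 [:: 1; 1; 1; 1; -1; -1; -1; -1]).

(* Here 'rV_(3 + (3 + 3)) is R^9, its elements being the triples (x; y; z). *)
Definition triple (x y z : 'rV[R]_3) : 'rV[R]_(3 + (3 + 3)) :=
  row_mx x (row_mx y z).

Definition A2_positive_roots : {fset 'rV[R]_3} :=
  [fset row_of 3 [:: 1; -1; 0]; row_of 3 [:: 1; 0; -1];
        row_of 3 [:: 0; 1; -1]].

Definition A2_weights : {fset 'rV[R]_3} :=
  [fset (1 / 3) *: row_of 3 [:: 2; -1; -1];
        (1 / 3) *: row_of 3 [:: -1; 2; -1];
        (1 / 3) *: row_of 3 [:: -1; -1; 2]].

Definition E6_reps : {fset 'rV[R]_(3 + (3 + 3))} :=
  [fset triple x 0 0 | x in A2_positive_roots] `|`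
  [fset triple 0 x 0 | x in A2_positive_roots] `|`
  [fset triple 0 0 x | x in A2_positive_roots] `|`
  [fset triple x yz.1 yz.2 | x in A2_weights, yz in A2_weights `*` A2_weights].

Definition E6 : {fset 'rV[R]_(3 + (3 + 3))} :=
  E6_reps `|` [fset - a | a in E6_reps].

Definition tau : R := (1 + Num.sqrt 5) / 2.

Definition H4 : {fset 'rV[R]_4} :=
  roots_unit 4 `|` roots_half 4 `|`
  [fset col_perm p (sign_change s ((1 / 2) *: row_of 4 [:: tau; 1; tau^-1; 0]))
    | s : {ffun 'I_4 -> bool}, p : 'S_4 & ~~ odd_perm p].

(* Addition in 'I_3 is modulo 3. *)
Definition cyclic_shift (k : 'I_3) (a : 'rV[R]_3) : 'rV[R]_3 :=
  \row_i a 0 (i + k).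

Definition H3 : {fset 'rV[R]_3} :=
  [fset cyclic_shift k (sign_change s (row_of 3 [:: 1; 0; 0]))
    | s : {ffun 'I_3 -> bool}, k : 'I_3] `|`
  [fset cyclic_shift k (sign_change s (row_of 3 [:: 1; tau^-1; tau]))
    | s : {ffun 'I_3 -> bool}, k : 'I_3].

End RootSystems.

(* Main.v *)
(* All the lines have coordinates in Z[tau], where orthogonality is decidable,
   so each configuration is an explicit finite graph.  Saturation says that
   every clique of this graph extends to one of size d, and is decided by a
   pivoted clique search.  Non-colourability follows from a few frames, such
   that choosing in each of them an element of colour 1, not orthogonal to those
   chosen before, ends in a frame with no possible choice.

   The extension of E6 consists of 234 lines, and contains the 27 lines spanned
   by the minimal weights and the 135 lines spanned by sums of two orthogonal
   roots.  A minimal weight w is orthogonal to five pairwise orthogonal lines e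
   of the latter kind such that the complement of {w, e} contains a copy of F4.
   As F4 is non-colourable, w or e has colour 1; since two orthogonal e cannot
   both have colour 1, w has.  But some frame of the extension consists of lines
   each orthogonal to some w, a contradiction. *)
From Stdlib Require Import ZArith MSetPositive FMapPositive.
Require Import Defs.
From HB Require Import structures.
From mathcomp Require Import all_boot all_order all_algebra all_fingroup.
From mathcomp Require Import finmap.
From mathcomp Require Import reals.
From mathcomp Require Import ssrZ zify ring.

Set Implicit Arguments.
Unset Strict Implicit.
Unset Printing Implicit Defensive.

Import Order.TTheory GRing.Theory Num.Theory.
Local Open Scope fset_scope.
Local Open Scope ring_scope.

(** * Cliques and frames in a finite graph *)

Section CliqueSearch.
Variables (T : eqType) (adj : T -> pred T).
Implicit Types (x y p : T) (C X Y U M : seq T).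

Definition clique U := {in U &, forall x y, x != y -> adj x y}.

(* Decides whether every clique inside X extends to a clique of size k inside
   C.  A clique either lies in the neighbourhood of the pivot p (up to p
   itself) or contains a non-neighbour y of p; in the latter case the
   non-neighbours preceding y may be discarded. *)
Fixpoint extendable (k : nat) C X : bool :=
  if k is k'.+1 then
    if C is p :: _ then
      let Z := filter (adj p) X in
      let fix others Y :=
        if Y is y :: Y' then
          extendable k' (filter (adj y) C) (filter (adj y) (Y' ++ Z))
            && others Y'
        else true in
      extendable k' (filter (adj p) C) Z
        && others [seq y <- X | ~~ adj p y && (y != p)]
    else false
  else nilp X.

(** Induction on [k]. If [U], apart from [p], lies in the neighbourhood of [p], then [p] is put into
    the answer and the rest of [U] is extended among the neighbours of [p]. Otherwise the same is
    done with the first non-neighbour of [p] that belongs to [U]. *)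
Lemma extendableP k C X U :
    {in C &, symmetric adj} -> {in C, forall x, ~~ adj x x} ->
    {subset X <= C} -> extendable k C X -> {subset U <= X} -> clique U ->
  exists M, [/\ {subset U <= M}, {subset M <= C}, size M = k, uniq M
              & clique M].
Proof.
elim: k C X U => [|k IHk] C X U symC irrC XC /=.
  case: X XC => // _ _ U0 _; exists [::]; split=> //.
case: C symC irrC XC => [//|p C0]; set C := p :: C0 => symC irrC XC.
(* The inductive step common to both cases: a clique of size [k] found among the neighbours of [y]
   is completed by [y] itself. *)
have step y X' U' : y \in C -> {subset X' <= filter (adj y) C} ->
    extendable k (filter (adj y) C) X' -> clique U' ->
    {subset filter (predC1 y) U' <= X'} ->
    exists M, [/\ {subset U' <= M}, {subset M <= C}, size M = k.+1, uniq M
                & clique M].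
  move=> yC XN extX cU' UX; have NC: {subset filter (adj y) C <= C}.
    by move=> z; rewrite mem_filter => /andP[].
  have [|||M [UM MN sM uM cM]] := IHk _ _ _ _ _ XN extX UX.
  - by move=> a b /NC aC /NC bC; apply: symC.
  - by move=> a /NC; apply: irrC.
  - move=> a b; rewrite !mem_filter => /andP[_ aU] /andP[_ bU].
    exact: cU'.
  have yM z : z \in M -> adj y z && (z \in C).
    by move=> /MN; rewrite mem_filter.
  exists (y :: M); split=> /=.
  - move=> z zU; rewrite inE; case: eqVneq => //= zy.
    by apply: UM; rewrite mem_filter /= zy.
  - by move=> z; rewrite inE => /predU1P[->|/yM/andP[]].
  - by rewrite sM.
  - rewrite uM andbT; apply/negP => /yM /andP[yy _].
    by move: (irrC _ yC); rewrite yy.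
  - move=> a b; rewrite !inE => /predU1P[->|aM] /predU1P[->|bM].
    + by rewrite eqxx.
    + by move=> _; have /andP[] := yM _ bM.
    + by move=> _; have /andP[? ?] := yM _ aM; rewrite symC.
    + exact: cM.
set Z := filter (adj p) X; set others := fix others Y := _.
move=> /andP[extp extY] UX cU; have pC : p \in C by rewrite mem_head.
have [UZ|] := boolP (all (mem Z) (filter (predC1 p) U)).
  apply: (step p Z U) => //; last by move=> z /(allP UZ).
  by move=> z; rewrite !mem_filter => /andP[-> /XC].
rewrite -has_predC => /hasP[y0]; rewrite !mem_filter /= => /andP[y0p y0U].
rewrite mem_filter (UX _ y0U) andbT => y0Z.
have: has (mem [seq y <- X | ~~ adj p y && (y != p)]) U.
  by apply/hasP; exists y0; rewrite //= mem_filter y0Z y0p UX.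
have: {subset U <= [seq y <- X | ~~ adj p y && (y != p)] ++ Z}.
  move=> z zU; rewrite mem_cat !mem_filter UX // !andbT.
  case: (boolP (adj p z)) => [|_]; rewrite ?orbT //= orbF.
  (* The pivot is not in [U] here, for it would then be adjacent to [y0]. *)
  apply: contraNneq y0Z => zp; rewrite -zp; apply: cU => //.
  by rewrite zp eq_sym.
have: {subset [seq y <- X | ~~ adj p y && (y != p)] <= X}.
  by move=> z; rewrite mem_filter => /andP[].
elim: [seq y <- X | _] extY => [|y Y IHY] /=.
  by move=> _ _ _ /hasP[].
move=> /andP[exty extY] YX UYZ hasY.
have [yU|yU] := boolP (y \in U).
  apply: (step y (filter (adj y) (Y ++ Z)) U) => //.
  - by apply: XC; rewrite YX ?mem_head.
  - move=> z; rewrite !mem_filter mem_cat => /andP[-> /=] /orP[zY|].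
      by apply/XC/YX; rewrite inE zY orbT.
    by rewrite mem_filter => /andP[_ /XC].
  - move=> z; rewrite !mem_filter /= => /andP[zy zU].
    rewrite cU //= 1?eq_sym //.
    by have := UYZ _ zU; rewrite inE (negbTE zy).
apply: IHY => //.
- by move=> z zY; apply: YX; rewrite inE zY orbT.
- move=> z zU; have := UYZ z zU.
  by rewrite inE; case: eqVneq => // zy; rewrite -zy zU in yU.
- have /hasP[z zU] := hasY; rewrite /= inE => /predU1P[zy|zY].
    by rewrite -zy zU in yU.
  by apply/hasP; exists z.
Qed.

(* Goes through the frames fs in order, branching on the element of the frame
   that gets the colour 1; ones lists the elements already coloured 1. *)
Fixpoint refutes (fs : seq (seq T)) (ones : seq T) : bool :=
  if fs is f :: fs' then
    all (fun x => if has (fun y => adj y x) ones then true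
                  else refutes fs' (x :: ones)) f
  else false.

(** In each frame follow an element that [c] colours 1. This branch of the search is never cut,
    because elements of colour 1 are not adjacent, so it reaches the end of [fs], where the answer
    is [false]. *)
Lemma refutesP (c : T -> bool) fs ones :
    (forall x y, adj y x -> c y -> ~~ c x) -> {in fs, forall f, has c f} ->
    all c ones -> ~~ refutes fs ones.
Proof.
move=> c2; elim: fs ones => //= f fs IHfs ones c1 cones.
have /hasP[x xf cx] := c1 f (mem_head _ _).
rewrite -has_predC; apply/hasP; exists x => //=.
case: hasP => [[y yones yx]|_].
  by have := c2 _ _ yx (allP cones _ yones); rewrite cx.
by apply: IHfs => [g gfs|/=]; rewrite ?c1 ?cx // inE gfs orbT.
Qed.

Fixpoint has_clique (k : nat) C : bool :=
  if k is k'.+1 then has (fun x => has_clique k' (filter (adj x) C)) C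
  else true.

(** Used contrapositively: when the search fails among the vertices of colour 0, every frame
    contains a vertex of colour 1. *)
Lemma pairwise_has_clique C U :
  {subset U <= C} -> pairwise adj U -> has_clique (size U) C.
Proof.
elim: U C => //= x U IHU C UC /andP[xU pU].
apply/hasP; exists x; first by rewrite UC ?mem_head.
by apply: IHU => // y yU; rewrite mem_filter (allP xU) // UC // inE yU orbT.
Qed.

End CliqueSearch.
(** * Configurations of lines realizing a graph *)

Section Realization.
Variables (R : realType) (n : nat) (T : choiceType) (adj : T -> pred T).
Variables (V : {vspace 'rV[R]_n}) (line : T -> {vspace 'rV[R]_n}) (vs : seq T).
Hypothesis adjP : forall x y, x \in vs -> y \in vs ->
  reflect (perp (line x) (line y)) (adj x y).
Hypothesis adj_irr : {in vs, forall x, ~~ adj x x}.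

Let A := [fset line x | x in vs].

Lemma perp_sym (K L : {vspace 'rV[R]_n}) : perp K L -> perp L K.
Proof.
move=> KL u v uL vK; rewrite -(KL v u vK uL).
by apply: eq_bigr => i _; rewrite mulrC.
Qed.

Let adj_sym : {in vs &, symmetric adj}.
Proof.
by move=> x y xV yV; apply/adjP/adjP => //; apply: perp_sym.
Qed.

Let line_in x : x \in vs -> line x \in A.
Proof. by move=> xV; apply: in_imfset. Qed.

(** The lines of [U] are lifted to vertices, the resulting clique is extended in the graph, and the
    extension is mapped back to lines. *)
Lemma realization_saturated : extendable adj (\dim V) vs vs -> saturated V A.
Proof.
move=> ext U /fsubsetP UA cU.
have pick_vertex L : L \in A -> exists x, (x \in vs) && (line x == L).
  by move=> /imfsetP[x /= xV ->]; exists x; rewrite xV eqxx.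
(* [W] picks one vertex for each line of [U]. Distinct vertices may a priori give the same line, so
   injectivity on [W] is built into the choice. *)
have [W [WV WU UW]] : exists W : seq T,
    [/\ {subset W <= vs}, {in W, forall x, line x \in U}
       & {in W &, injective line} /\
         forall L, L \in U -> has (fun x => line x == L) W].
  elim/fset1U_rect: U UA cU => [|L U LU IHU] UA cU.
    by exists [::]; split=> //; split=> // L; rewrite inE.
  have [||W [WV WU [Winj UW]]] := IHU.
  - by move=> K KU; apply: UA; rewrite !inE KU orbT.
  - by move=> K M KU MU; apply: cU; rewrite !inE ?KU ?MU orbT.
  have [x /andP[xV /eqP xL]] := pick_vertex L (UA L (fset1U1 _ _)).
  have neL y : y \in W -> line y != line x.
    by move=> /WU yU; apply: contraNneq LU => e; rewrite -xL -e.
  exists (x :: W); split; [| |split].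
  - by move=> y; rewrite inE => /predU1P[->|/WV].
  - move=> y; rewrite inE => /predU1P[->|/WU yU]; first by rewrite xL fset1U1.
    by rewrite !inE yU orbT.
  - move=> y z; rewrite !inE => /predU1P[->|yW] /predU1P[->|zW] // e.
    + by move: (neL z zW); rewrite e eqxx.
    + by move: (neL y yW); rewrite e eqxx.
    + exact: Winj.
  - move=> K; rewrite !inE => /predU1P[->|/UW /=]; first by rewrite /= xL eqxx.
    by move=> ->; rewrite orbT.
case: UW => Winj UW.
have cW : clique adj W.
  move=> x y xW yW xy; apply/adjP; rewrite ?WV //.
  by apply: cU; rewrite ?WU //; apply: contraNneq xy => /Winj ->.
have [M [WM MV sM uM cM]] :=
  extendableP adj_sym adj_irr (fun _ => id) ext WV cW.
(* Two distinct vertices of [M] are adjacent; if they had the same line, that line would be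
   orthogonal to itself, against irreflexivity. Hence [M] gives exactly [\dim V] lines. *)
have Minj : {in M &, injective line}.
  move=> x y xM yM e; apply/eqP/negPn/negP => xy.
  have xV := MV x xM; have yV := MV y yM.
  have /(adjP xV yV) := cM x y xM yM xy; rewrite -e => /(adjP xV xV).
  exact/negP/adj_irr.
exists [fset line x | x in M]; split.
- apply/fsubsetP => L /UW /hasP[x xW /eqP <-].
  by apply: in_imfset; apply: WM.
- by apply/fsubsetP => L /imfsetP[x /= /MV xV ->]; apply: line_in.
- rewrite card_in_imfset /=; last exact: Minj.
  by rewrite undup_id.
- move=> K L /imfsetP[x /= xM ->] /imfsetP[y /= yM ->] xy.
  apply/adjP; rewrite ?MV //; apply: cM => //.
  by apply: contraNneq xy => ->.
Qed.

Definition frame (f : seq T) : bool :=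
  [&& size f == \dim V, all (mem vs) f & pairwise adj f].

Lemma frame_has (c : T -> bool) f (v : A -> bool) :
    good_bicolouring V v ->
    (forall x (xV : x \in vs), v [` line_in xV] = c x) ->
  frame f -> has c f.
Proof.
move=> [v1 _] vc /and3P[/eqP sf /allP fV pf].
have lt_f (i : 'I_(\dim V)) : (i < size f)%N by rewrite sf.
pose x0 (i : 'I_(\dim V)) : T := tnth (in_tuple f) (Ordinal (lt_f i)).
have fx i : x0 i \in f by apply: mem_tnth.
pose X i : A := [` line_in (fV _ (fx i))].
have [|i0 [vi0 _]] := v1 X.
  move=> i j ij; apply: (elimT (adjP (fV _ (fx i)) (fV _ (fx j)))).
  (* [pairwise] speaks only of entries in increasing position; the other order follows by
     symmetry. *)
  have {ij} : (i < j)%N || (j < i)%N by rewrite -neq_ltn.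
  have xE k : x0 k = nth (x0 i) f k by rewrite /x0 (tnth_nth (x0 i)).
  have /(pairwiseP (x0 i)) pP := pf.
  case/orP=> lt_ij; last rewrite (adj_sym (fV _ (fx i)) (fV _ (fx j))).
    by rewrite (xE j) {1}(xE i); apply: pP; rewrite ?inE ?lt_f.
  by rewrite (xE j) {2}(xE i); apply: pP; rewrite ?inE ?lt_f.
by apply/hasP; exists (x0 i0); rewrite // -(vc _ (fV _ (fx i0))) vi0.
Qed.

Lemma realization_not_colourable (fs : seq (seq T)) :
  all frame fs -> refutes adj fs [::] -> ~ colourable V A.
Proof.
move=> /allP frame_fs ref [v gv].
(* The colouring is carried over to all of [T], with the value [false] off [vs]; [insub] supplies
   the membership proof that an argument of [v] contains. *)
pose c x := (x \in vs) && oapp v false (insub (line x)).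
have vc x (xV : x \in vs) : v [` line_in xV] = c x.
  by rewrite /c xV insubT ?line_in //= => h; congr v; apply: val_inj.
apply/negP: ref; apply: (refutesP (c := c)) => // [x y yx|f ffs].
  rewrite {1}/c => /andP[yV]; rewrite -/(c y) => cy.
  have [xV|xV] := boolP (x \in vs); last by rewrite /c (negbTE xV).
  have [_ v2] := gv; rewrite -(vc x xV); apply/negbT/(v2 [` line_in yV]).
    by apply/adjP=> //; rewrite adj_sym.
  by rewrite vc /c yV.
by apply: frame_has gv _ (frame_fs f ffs) => x xV; apply: vc.
Qed.

(** The lines of [ones] get colour 1. Independence of [ones] gives condition (ii), and with it
    uniqueness in (i); existence in (i) holds because no frame avoids [ones]. *)
Lemma realization_colourable (ones : seq T) :
    {subset ones <= vs} -> {in ones &, forall x y, ~~ adj x y} ->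
    ~~ has_clique adj (\dim V) [seq x <- vs | x \notin ones] ->
  colourable V A.
Proof.
move=> onesV ones_indep no_clique.
pose v (L : A) := has (fun x => line x == val L) ones.
have v2 (K L : A) : perp (val L) (val K) -> v K -> v L = false.
  move=> LK /hasP[x xO /eqP xK]; apply/negP => /hasP[y yO /eqP yL].
  move: (ones_indep y x yO xO); rewrite -xK -yL in LK.
  by rewrite (introT (adjP (onesV y yO) (onesV x xO)) LK).
exists v; split; last by move=> K L; apply: v2.
move=> X perpX; have [/existsP[i vi]|/existsPn v0] := boolP [exists i, v (X i)].
  exists i; split=> // j vj; apply/eqP/negPn/negP => ij.
  by move: (v2 (X j) (X i) (perpX i j ij) vj); rewrite vi.
have /fin_all_exists[x xP] i : exists x, x \in vs /\ line x = val (X i).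
  by have /imfsetP[x /= xV ->] := fsvalP (X i); exists x.
case/negP: no_clique; rewrite -[\dim V]size_enum_ord -(size_map x).
apply: pairwise_has_clique.
  move=> _ /mapP[i _ ->]; have [xV xX] := xP i; rewrite mem_filter xV andbT.
  by apply: contra (v0 i) => xO; apply/hasP; exists (x i); rewrite ?xX.
rewrite pairwise_map; have := enum_uniq 'I_(\dim V).
rewrite uniq_pairwise; apply: sub_pairwise => i j /= ij.
have [[iV iX] [jV jX]] := (xP i, xP j).
by apply/adjP => //; rewrite iX jX; apply: perpX.
Qed.

End Realization.
(** * Vectors with coordinates in Z[tau] *)

(** Vertices will be binary numbers. Their choice structure, which the formation of finite sets of
    lines requires, comes from countability. *)
HB.instance Definition _ := hasDecEq.Build positive Pos.eqb_spec.
HB.instance Definition _ := Countable.copy positive (can_type Pos2Nat.id).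

(* ssrint has taken the delimiting key Z for int_scope. *)
Delimit Scope Z_scope with BZ.

(* (a, b) stands for a + b tau. *)
Definition quad : Type := (Z * Z)%type.

Definition qadd (p q : quad) : quad := (p.1 + q.1, p.2 + q.2)%BZ.
Definition qopp (p : quad) : quad := (- p.1, - p.2)%BZ.
(** The product is reduced by [tau ^ 2 = tau + 1]. *)
Definition qmul (p q : quad) : quad :=
  (p.1 * q.1 + p.2 * q.2, p.1 * q.2 + p.2 * q.1 + p.2 * q.2)%BZ.

Section QuadValue.
Variable R : realType.

Definition ev (p : quad) : R :=
  (int_of_Z p.1)%:~R + (int_of_Z p.2)%:~R * tau R.

Lemma tau_sqr : tau R * tau R = tau R + 1.
Proof.
have : Num.sqrt 5 ^+ 2 = 5 :> R by rewrite sqr_sqrtr.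
by rewrite /tau; set s := Num.sqrt 5; rewrite expr2 => h; field: h.
Qed.

Lemma evD p q : ev (qadd p q) = ev p + ev q.
Proof. by rewrite /ev /= !(rmorphD int_of_Z) !rmorphD /=; ring. Qed.

Lemma evN p : ev (qopp p) = - ev p.
Proof. by rewrite /ev /= !(rmorphN int_of_Z) !rmorphN /=; ring. Qed.

Lemma evM p q : ev (qmul p q) = ev p * ev q.
Proof.
rewrite /ev /= !(rmorphD int_of_Z) !(rmorphM int_of_Z) !rmorphD !rmorphM /=.
set a := _%:~R; set b := _%:~R; set c := _%:~R; set d := _%:~R.
by have := tau_sqr; set t := tau R => tt; ring: tt.
Qed.

(** For nonzero [m] and [n], the exponent of 5 is even on the left and odd on the right. *)
Lemma int_sqr5_eq0 (m n : int) : m * m = 5 * (n * n) -> n = 0.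
Proof.
move=> /(congr1 absz); rewrite !abszM.
have [//|n0] := eqVneq n 0; have [->|m0] := eqVneq m 0.
  by rewrite mul0n; case: n n0 => [[]|].
move=> /(congr1 (logn 5)); rewrite !lognM ?absz_gt0 ?muln_gt0 ?absz_gt0 ?n0 //=.
have -> : logn 5 `|5%Z| = 1%N by [].
lia.
Qed.

(* The norm a^2 + ab - b^2 of a + b tau vanishes only at 0 since 5 is not a
   square. *)
Lemma ev_eq0 p : (ev p == 0) = (p == (0, 0)%BZ).
Proof.
apply/eqP/eqP => [|->]; last by rewrite /ev /= mul0r addr0.
case: p => a b; rewrite /ev /=.
set x := int_of_Z a; set y := int_of_Z b => e.
have : (x * x + x * y - y * y)%:~R = 0 :> R.
  rewrite !rmorphD rmorphN !rmorphM /=.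
  have -> : x%:~R = - (y%:~R * tau R) :> R by apply/eqP; rewrite -addr_eq0 e.
  have := tau_sqr; set t := tau R => tt; ring: tt.
move=> /eqP; rewrite intr_eq0 => /eqP norm0.
(* Completing the square: four times the norm is [(2 * x + y) ^ 2 - 5 * y ^ 2]. *)
have y0 : y = 0 by apply: (@int_sqr5_eq0 (2 * x + y)); lia.
have x0 : x = 0 by move: norm0; rewrite y0; lia.
by rewrite -(int_of_ZK a) -(int_of_ZK b) -/x -/y x0 y0.
Qed.

End QuadValue.

Definition code : Type := seq quad.

Definition dotc (u v : code) : quad :=
  foldr (fun p s => qadd (qmul p.1 p.2) s) (0, 0)%BZ (zip u v).

Definition orth (u v : code) : bool := dotc u v == (0, 0)%BZ.

Definition vec (R : realType) n (u : code) : 'rV[R]_n :=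
  row_of n (map (ev R) u).

(** * Inner products of coded vectors *)

Section Dotp.
Variables (R : realType) (n : nat).
Implicit Types u v w : 'rV[R]_n.

Lemma dotpC u v : dotp u v = dotp v u.
Proof. by apply: eq_bigr => i _; rewrite mulrC. Qed.

Lemma dotpE u v : dotp u v = (u *m v^T) 0 0.
Proof. by rewrite mxE; apply: eq_bigr => i _; rewrite mxE. Qed.

Lemma dotpDl u v w : dotp (u + v) w = dotp u w + dotp v w.
Proof. by rewrite !dotpE mulmxDl mxE. Qed.

Lemma dotpZl a u v : dotp (a *: u) v = a * dotp u v.
Proof. by rewrite !dotpE -scalemxAl mxE. Qed.

Lemma dotpZr a u v : dotp u (a *: v) = a * dotp u v.
Proof. by rewrite dotpC dotpZl dotpC. Qed.

Lemma dotp0 u : dotp u 0 = 0.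
Proof. by rewrite dotpE trmx0 mulmx0 mxE. Qed.

Lemma dotp_eq0 u : (dotp u u == 0) = (u == 0).
Proof.
apply/eqP/eqP => [|->]; last exact: dotp0.
move=> /eqP; rewrite psumr_eq0 => [/allP u0|i _]; last by rewrite -expr2 sqr_ge0.
apply/rowP => i; rewrite mxE; apply/eqP.
by have := u0 i (mem_index_enum i); rewrite mulf_eq0 orbb.
Qed.

Lemma perp_line u v : perp <[u]> <[v]> <-> dotp u v = 0.
Proof.
split=> [uv|uv _ _ /vlineP[a ->] /vlineP[b ->]].
  exact: uv (memv_line u) (memv_line v).
by rewrite dotpZl dotpZr uv !mulr0.
Qed.

Lemma dotp_vec (x y : code) :
  size x = n -> size y = n -> dotp (vec R n x) (vec R n y) = ev R (dotc x y).
Proof.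
move=> sx sy; rewrite /dotp; under eq_bigr do rewrite !mxE.
elim: n x y sx sy => [|m IHm] [|p x] [|q y] //=.
  by rewrite big_ord0 /ev /= mul0r addr0.
move=> [sx] [sy]; rewrite big_ord_recl /= evD evM -IHm //.
Qed.

(** Since [ev] vanishes only at [(0, 0)], integer arithmetic decides real orthogonality exactly, in
    both directions. *)
Lemma dotp_vec_eq0 (x y : code) : size x = n -> size y = n ->
  (dotp (vec R n x) (vec R n y) == 0) = orth x y.
Proof. by move=> sx sy; rewrite dotp_vec // ev_eq0. Qed.

End Dotp.

(** * Dimensions from orthogonal families *)

Section Dimension.
Variables (R : realType) (n : nat).
Implicit Types (u v : 'rV[R]_n) (X Y : seq 'rV[R]_n) (V : {vspace 'rV[R]_n}).

Definition orthogonal X : bool :=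
  pairwise (fun u v => dotp u v == 0) X && (0 \notin X).

Lemma dotp_span X v u :
  {in X, forall x, dotp x v = 0} -> u \in <<X>>%VS -> dotp u v = 0.
Proof.
move=> Xv /(@coord_span _ _ _ (in_tuple X)) ->.
rewrite dotpE mulmx_suml summxE big1 // => i _.
by rewrite -scalemxAl mxE -dotpE Xv ?mulr0 // mem_nth.
Qed.

(** A vector in the span of the later ones would be orthogonal to itself, hence zero. *)
Lemma orthogonal_free X : orthogonal X -> free X.
Proof.
rewrite /orthogonal; elim: X => [|x X IHX] /=; first by rewrite nil_free.
rewrite inE negb_or free_cons => /andP[/andP[xX pX] /andP[x0 X0]].
rewrite IHX ?pX ?X0 // andbT; apply: contra x0 => xspan.
rewrite eq_sym -dotp_eq0; apply/eqP/(dotp_span (X := X)) => // y yX.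
by rewrite dotpC; apply/eqP/(allP xX).
Qed.

Section Complement.
Variables (V : {vspace 'rV[R]_n}) (X Y : seq 'rV[R]_n).
Hypotheses (XV : {subset X <= V}) (orthX : orthogonal X) (orthY : orthogonal Y).
Hypotheses (VY : {in V & Y, forall v y, dotp v y = 0}).
Hypothesis sXY : (size X + size Y)%N = n.

Let capVY : (V :&: <<Y>>)%VS = 0%VS.
Proof.
apply/eqP; rewrite -subv0; apply/subvP => v; rewrite memv_cap memv0.
move=> /andP[vV vY]; rewrite -dotp_eq0; apply/eqP/(dotp_span _ vY).
by move=> y yY; rewrite dotpC VY.
Qed.

Let dimVY : \dim (V + <<Y>>) = (\dim V + size Y)%N.
Proof.
have := dimv_sum_cap V <<Y>>%VS; rewrite capVY dimv0 addn0 => ->.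
by congr addn; apply/eqP/orthogonal_free.
Qed.

(** The sum of [V] and the span of [Y] is direct, so [\dim V] is at most [n - size Y], which is
    [size X]; the free family [X] inside [V] gives the other inequality. *)
Lemma dim_complement : \dim V = size X.
Proof.
apply/eqP; rewrite eqn_leq; apply/andP; split.
  rewrite -(leq_add2r (size Y)) sXY -dimVY (leq_trans (dimvS (subvf _))) //.
  by rewrite dimvf /dim /= mul1n.
have /eqP <- := orthogonal_free orthX.
by apply/dimvS/span_subvP.
Qed.

(** By dimension, [V] and the span of [Y] together fill the space. The component of [u] along [Y] is
    orthogonal to [Y], hence to itself, and vanishes. *)
Lemma memv_complement u : {in Y, forall y, dotp u y = 0} -> u \in V.
Proof.
move=> uY; have : u \in (V + <<Y>>)%VS.
  have /eqP -> : (V + <<Y>>)%VS == fullv; last exact: memvf.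
  by rewrite eqEdim subvf dimVY dim_complement sXY dimvf /dim /= mul1n.
move=> /memv_addP[v vV [y yY uE]].
suff -> : u = v by [].
apply/eqP; rewrite -subr_eq0 uE addrC addKr -dotp_eq0.
apply/eqP/(dotp_span _ yY) => z zY; rewrite dotpC.
have := uY z zY; rewrite uE dotpDl VY // add0r => yz.
exact: yz.
Qed.

End Complement.
End Dimension.

(** * Orthogonality graphs of lists of codes *)

Section Graph.
Implicit Types (L : seq code) (l : seq (positive * code)).

(** Vertices are 1-based positions, so that [graph] can tabulate orthogonality once in binary tries
    and the searches look up adjacency instead of recomputing inner products. *)
Definition labels L : seq positive :=
  [seq Pos.of_succ_nat i | i <- iota 0 (size L)].

Definition code_at L (i : positive) : code := nth [::] L (Pos.to_nat i).-1.

Definition neighbours l (u : code) : PositiveSet.t :=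
  foldr (fun x S => if orth u x.2 then PositiveSet.add x.1 S else S)
    PositiveSet.empty l.

Definition graph L : PositiveMap.t PositiveSet.t :=
  let l := zip (labels L) L in
  foldr (fun x G => PositiveMap.add x.1 (neighbours l x.2) G)
    (PositiveMap.empty _) l.

Definition adj (G : PositiveMap.t PositiveSet.t) (i : positive) :
    pred positive :=
  if PositiveMap.find i G is Some s then PositiveSet.mem^~ s else pred0.

Lemma code_at_label L k : code_at L (Pos.of_succ_nat k) = nth [::] L k.
Proof. by rewrite /code_at SuccNat2Pos.id_succ. Qed.

Lemma code_at_in L i : i \in labels L -> code_at L i \in L.
Proof.
move=> /mapP[k]; rewrite mem_iota => /andP[_ lt_k] ->.
by rewrite code_at_label mem_nth.
Qed.

Lemma in_code_at L u : u \in L -> exists2 i, i \in labels L & code_at L i = u.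
Proof.
move=> uL; exists (Pos.of_succ_nat (index u L)).
  by apply: map_f; rewrite mem_iota index_mem.
by rewrite code_at_label nth_index.
Qed.

(** In this form each table entry is a function of its key, so a lookup has the right value
    whichever insertion it meets. *)
Lemma zip_labels L : zip (labels L) L = [seq (i, code_at L i) | i <- labels L].
Proof.
apply: (@eq_from_nth _ (xH, [::])).
  by rewrite size_zip !size_map size_iota minnn.
move=> k; rewrite size_zip size_map size_iota minnn => lt_k.
rewrite nth_zip ?size_map ?size_iota // (nth_map xH) ?size_map ?size_iota //.
by rewrite (nth_map 0%N) ?size_iota // nth_iota // code_at_label.
Qed.

Lemma adj_graph L i j : i \in labels L -> j \in labels L ->
  adj (graph L) i j = orth (code_at L i) (code_at L j).
Proof.
move=> iL jL; rewrite /adj /graph /=; set N := neighbours _.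
have -> : PositiveMap.find i
    (foldr (fun x G => PositiveMap.add x.1 (N x.2) G) (PositiveMap.empty _)
       (zip (labels L) L)) = Some (N (code_at L i)).
  rewrite zip_labels; elim: (labels L) iL => //= k s IHs.
  rewrite inE PositiveMapAdditionalFacts.gsspec.
  by case: PositiveMap.E.eq_dec => [->|/eqP/negbTE -> /=] // /IHs.
rewrite {}/N /neighbours zip_labels.
have -> s : PositiveSet.mem j (foldr (fun x S =>
    if orth (code_at L i) x.2 then PositiveSet.add x.1 S else S)
    PositiveSet.empty [seq (k, code_at L k) | k <- s]) =
    has (fun k => (j == k) && orth (code_at L i) (code_at L k)) s.
  elim: s => //= k s <-; case: (orth _ _); last by rewrite andbF.
  rewrite andbT; apply/idP/orP.
    move=> /PositiveSet.mem_spec/PositiveSet.add_spec[->|]; first by left.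
    by move=> /PositiveSet.mem_spec; right.
  move=> jkS; apply/PositiveSet.mem_spec/PositiveSet.add_spec.
  by case: jkS => [/eqP|/PositiveSet.mem_spec]; [left|right].
apply/hasP/idP => [[k _ /andP[/eqP<-]]|ij] //.
by exists j; rewrite ?eqxx.
Qed.

End Graph.

(** * Boolean checks for saturation and colourability *)

Section Configuration.
Variables (R : realType) (n : nat).
Implicit Types (L : seq code) (V : {vspace 'rV[R]_n}).

Definition lines_of L : {fset {vspace 'rV[R]_n}} :=
  [fset <[vec R n u]>%VS | u in L].

Definition line_at L (i : positive) : {vspace 'rV[R]_n} :=
  <[vec R n (code_at L i)]>%VS.

Lemma lines_of_labels L : lines_of L = [fset line_at L i | i in labels L].
Proof.
apply/fsetP => K; apply/imfsetP/imfsetP => /= [[u uL ->]|[i iL ->]].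
  by have [i iL <-] := in_code_at uL; exists i.
by exists (code_at L i); rewrite ?code_at_in.
Qed.

(** A code of length [n] that is orthogonal to itself has value zero; excluding it ensures that each
    code spans a line and that the graph is irreflexive. *)
Definition valid_codes L : bool :=
  all (fun u => (size u == n) && ~~ orth u u) L.

Lemma adj_perp L i j : valid_codes L -> i \in labels L -> j \in labels L ->
  reflect (perp (line_at L i) (line_at L j)) (adj (graph L) i j).
Proof.
move=> /allP val_L iL jL; rewrite adj_graph // -(@dotp_vec_eq0 R n).
- by apply: (iffP eqP) => /perp_line.
- by have /andP[/eqP] := val_L _ (code_at_in iL).
- by have /andP[/eqP] := val_L _ (code_at_in jL).
Qed.

Lemma adj_irreflexive L : valid_codes L ->
  {in labels L, forall i, ~~ adj (graph L) i i}.
Proof.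
move=> /allP val_L i iL; rewrite adj_graph //.
by have /andP[] := val_L _ (code_at_in iL).
Qed.

Definition saturation_check (d : nat) L : bool :=
  valid_codes L && extendable (adj (graph L)) d (labels L) (labels L).

Lemma saturation_valid d L u :
  saturation_check d L -> u \in L -> size u = n /\ ~~ orth u u.
Proof. by move=> /andP[/allP valL _] /valL /andP[/eqP]. Qed.

Lemma saturated_lines V L :
  saturation_check (\dim V) L -> saturated V (lines_of L).
Proof.
move=> /andP[val_L ext]; rewrite lines_of_labels.
apply: realization_saturated ext => [i j iL jL|]; first exact: adj_perp.
exact: adj_irreflexive.
Qed.

Definition refutation_check (d : nat) L (fs : seq (seq positive)) : bool :=
  let G := graph L in
  [&& valid_codes L, refutes (adj G) fs [::]
    & all (fun f => [&& size f == d, all (mem (labels L)) f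
                      & pairwise (adj G) f]) fs].

Lemma not_colourable_lines V L fs :
  refutation_check (\dim V) L fs -> ~ colourable V (lines_of L).
Proof.
move=> /and3P[val_L ref frames]; rewrite lines_of_labels.
apply: realization_not_colourable frames ref => i j iL jL.
exact: adj_perp.
Qed.

Definition colouring_check (d : nat) L (ones : seq positive) : bool :=
  let G := graph L in
  [&& valid_codes L, all (mem (labels L)) ones,
      all (fun i => ~~ has (adj G i) ones) ones
    & ~~ has_clique (adj G) d [seq i <- labels L | i \notin ones]].

Lemma colourable_lines V L ones :
  colouring_check (\dim V) L ones -> colourable V (lines_of L).
Proof.
move=> /and4P[val_L /allP onesL /allP indep no_clique]; rewrite lines_of_labels.
apply: realization_colourable onesL _ no_clique => [i j iL jL|i j iO jO].
  exact: adj_perp.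
by apply: (hasPn (indep i iO)).
Qed.

End Configuration.
(** * Enumeration of the root systems *)

Definition zcode (s : seq Z) : code := [seq (z, 0%BZ) | z <- s].

Definition addc (u v : code) : code := [seq qadd p.1 p.2 | p <- zip u v].
Definition oppc (u : code) : code := map qopp u.

(** Keeps one of [w] and [- w], which span the same line. The labels in the certificates refer to
    the order of the resulting list. *)
Definition half (W : seq code) : seq code :=
  foldr (fun w L => if (w \in L) || (oppc w \in L) then L else w :: L) [::] W.

Fixpoint bools (n : nat) : seq (seq bool) :=
  if n is m.+1 then [seq b :: t | b <- [:: false; true], t <- bools m]
  else [:: [::]].

Definition signed (s : seq bool) (u : code) : code :=
  [seq if p.1 then qopp p.2 else p.2 | p <- zip s u].

Definition signings (u : code) : seq code :=
  [seq signed s u | s <- bools (size u)].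

Definition reindex (f : nat -> nat) (u : code) : code :=
  mkseq (fun i => nth (0, 0)%BZ u (f i)) (size u).

(** The entry is 2 because these codes stand for doubled roots, which turns the halves in the other
    roots into integers. *)
Definition unit_code (n : nat) (x : bool * nat) : code :=
  mkseq (fun j => if j == x.2 then if x.1 then (- 2, 0)%BZ else (2, 0)%BZ
                  else (0, 0)%BZ) n.

Definition unit_codes (n : nat) : seq code :=
  [seq unit_code n (b, i) | b <- [:: false; true], i <- iota 0 n].

Definition pair_codes (n : nat) : seq code :=
  [seq addc (unit_code n (s.1, p.1)) (unit_code n (s.2, p.2))
    | s <- [seq (b, b') | b <- [:: false; true], b' <- [:: false; true]],
      p <- [seq p <- [seq (i, j) | i <- iota 0 n, j <- iota 0 n]
             | (p.1 < p.2)%N]].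

Definition half_code (n : nat) : code := nseq n (1, 0)%BZ.

Definition swap (i j x : nat) : nat :=
  if x == i then j else if x == j then i else x.

(** The swap of 0 acts first, in accordance with the product of permutations, whose left factor is
    applied first. *)
Definition swaps (t : nat * nat * nat) (x : nat) : nat :=
  swap 2 t.2 (swap 1 t.1.2 (swap 0 t.1.1 x)).

(* Every permutation of {0, 1, 2, 3} is swaps (i, j, k) for exactly one triple
   with i <= 3, 1 <= j <= 3 and 2 <= k <= 3. *)
Definition even_swaps : seq (nat * nat * nat) :=
  [seq t <- [seq (ij, k) | ij <- [seq (i, j) | i <- iota 0 4, j <- iota 1 3],
                           k <- iota 2 2]
    | ~~ ((t.1.1 != 0%N) (+) (t.1.2 != 1%N) (+) (t.2 != 2%N))].

Definition F4_codes : seq code :=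
  unit_codes 4 ++ pair_codes 4 ++ signings (half_code 4).

Definition E8_codes : seq code :=
  pair_codes 8 ++
  [seq signed s (half_code 8) | s <- bools 8 & ~~ odd (count id s)].

Definition E7_codes : seq code :=
  permutations (zcode [:: 2; -2; 0; 0; 0; 0; 0; 0]%BZ) ++
  permutations (zcode [:: 1; 1; 1; 1; -1; -1; -1; -1]%BZ).

(** The pair [(-1, 1)] is [tau - 1], the inverse of [tau]. *)
Definition H4_codes : seq code :=
  unit_codes 4 ++ signings (half_code 4) ++
  [seq reindex (swaps t) u
    | u <- signings [:: (0, 1); (1, 0); (-1, 1); (0, 0)]%BZ, t <- even_swaps].

Definition cyclic_codes (u : code) : seq code :=
  [seq reindex (fun i => (i + k) %% 3)%N w | w <- signings u, k <- iota 0 3].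

Definition H3_codes : seq code :=
  cyclic_codes [:: (1, 0); (0, 0); (0, 0)]%BZ ++
  cyclic_codes [:: (1, 0); (-1, 1); (0, 1)]%BZ.

Definition xi_codes : seq code :=
  map zcode [:: [:: 3; -3; 0]; [:: 3; 0; -3]; [:: 0; 3; -3]]%BZ.
Definition omega_codes : seq code :=
  map zcode [:: [:: 2; -1; -1]; [:: -1; 2; -1]; [:: -1; -1; 2]]%BZ.
Definition zero3 : code := zcode [:: 0; 0; 0]%BZ.

Definition rotations (t : code * code * code) : seq code :=
  let: (x, y, z) := t in [:: x ++ y ++ z; z ++ x ++ y; y ++ z ++ x].

Definition E6_rep_codes : seq code :=
  (([seq x ++ zero3 ++ zero3 | x <- xi_codes] ++
    [seq zero3 ++ x ++ zero3 | x <- xi_codes]) ++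
    [seq zero3 ++ zero3 ++ x | x <- xi_codes]) ++
  [seq x ++ yz | x <- omega_codes,
                 yz <- [seq y ++ z | y <- omega_codes, z <- omega_codes]].

Definition E6_codes : seq code := E6_rep_codes ++ map oppc E6_rep_codes.

(* With xi the three positive roots and omega the three weights of A2, the lines
   spanned by the cyclic shifts of (xi; 0; 0), (omega; 0; 0),
   (omega; omega'; omega''), (-2 omega; omega'; omega''), (omega; +-omega'; 0)
   and (xi; +-xi'; 0). *)
Definition E6_extension : seq code :=
  let omega_multiples c := [seq map (qmul (c, 0)%BZ) x | x <- omega_codes] in
  let triples A B C :=
    flatten [seq rotations t
              | t <- [seq (xy, z) | xy <- [seq (x, y) | x <- A, y <- B],
                                    z <- C]] in
  let zero := [:: zero3] in
  half (E6_rep_codes ++ triples omega_codes zero zero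
  ++ triples (omega_multiples (-2)%BZ) omega_codes omega_codes
  ++ triples omega_codes omega_codes zero
  ++ triples omega_codes (omega_multiples (-1)%BZ) zero
  ++ triples xi_codes xi_codes zero
  ++ triples xi_codes (map oppc xi_codes) zero).

(** * Correctness of the enumerations *)

Section Encodings.
Variable R : realType.

(* The scalar c clears the denominators of the roots. *)
Definition encodes n (c : R) (Phi : {fset 'rV[R]_n}) (W : seq code) : Prop :=
  forall a, (a \in Phi) = (c *: a \in [seq vec R n w | w <- W]).

Lemma encodesI n (c : R) (Phi : {fset 'rV[R]_n}) W : c != 0 ->
    (forall a, a \in Phi -> exists2 w, w \in W & c *: a = vec R n w) ->
    (forall w, w \in W -> exists2 a, a \in Phi & c *: a = vec R n w) ->
  encodes c Phi W.
Proof.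
move=> c0 PW WP a; apply/idP/mapP => [/PW //|[w /WP[b bP <-]]].
by move=> /(scalerI c0) ->.
Qed.

Lemma encodesU n (c : R) (Phi Psi : {fset 'rV[R]_n}) W X :
  encodes c Phi W -> encodes c Psi X -> encodes c (Phi `|` Psi) (W ++ X).
Proof. by move=> PW PX a; rewrite inE PW PX map_cat mem_cat. Qed.

Lemma ev0 : ev R (0, 0)%BZ = 0.
Proof. by rewrite /ev /= mul0r addr0. Qed.

Lemma vecE n (u : code) (i : 'I_n) : vec R n u 0 i = ev R (nth (0, 0)%BZ u i).
Proof.
rewrite mxE; have [lt_i|le_i] := ltnP i (size u); first exact: nth_map.
by rewrite !nth_default ?size_map // ev0.
Qed.

Lemma vec_addc n (u v : code) :
  size u = size v -> vec R n (addc u v) = vec R n u + vec R n v.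
Proof.
move=> suv; apply/rowP => i; rewrite [RHS]mxE !vecE -evD.
have [lt_i|le_i] := ltnP i (size u).
  by rewrite (nth_map ((0, 0), (0, 0))%BZ) ?size_zip -?suv ?minnn // nth_zip.
by rewrite !nth_default -?suv // size_map size_zip -suv minnn.
Qed.

Lemma vec_oppc n (u : code) : vec R n (oppc u) = - vec R n u.
Proof.
apply/rowP => i; rewrite [RHS]mxE !vecE -evN; congr (ev R _).
have [lt_i|le_i] := ltnP i (size u); first exact: nth_map.
by rewrite !nth_default ?size_map.
Qed.

Lemma encodes_opp n (c : R) (Phi : {fset 'rV[R]_n}) W :
  encodes c Phi W -> encodes c [fset - a | a in Phi] (map oppc W).
Proof.
move=> PW a; have -> : (a \in [fset - b | b in Phi]) = (- a \in Phi).
  apply/imfsetP/idP => [[b /= bP ->]|aP]; first by rewrite opprK.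
  by exists (- a); rewrite ?opprK.
rewrite PW scalerN -map_comp; apply/mapP/mapP => -[w wW].
  by move=> /eqP; rewrite eqr_oppLR -vec_oppc => /eqP; exists w.
by rewrite /= vec_oppc => ->; exists w; rewrite ?opprK.
Qed.

Lemma ev_int (z : Z) : ev R (z, 0%BZ) = (int_of_Z z)%:~R.
Proof. by rewrite /ev /= mul0r addr0. Qed.

Lemma vec_unit n b (i : 'I_n) :
  2 *: (sgn R b *: unit_vec R i) = vec R n (unit_code n (b, val i)).
Proof.
apply/rowP => j; rewrite vecE nth_mkseq // !mxE eqxx /= -val_eqE.
case: eqP => _; last by rewrite ev0 !mulr0.
by case: b; rewrite ev_int /sgn /= ?NegzE ?expr0 ?expr1 ?rmorphN /= !mulr1 ?mulrN1.
Qed.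

Lemma unit_codesP n w :
  reflect (exists b (i : 'I_n), w = unit_code n (b, val i))
    (w \in unit_codes n).
Proof.
apply: (iffP allpairsP) => [[[b k] [_ /= kn ->]]|[b [i ->]]].
  by rewrite mem_iota in kn; exists b, (Ordinal kn).
by exists (b, val i); rewrite /= mem_iota /= add0n ltn_ord; split=> //; case: (b).
Qed.

Lemma encodes_unit n : encodes 2 (roots_unit R n) (unit_codes n).
Proof.
apply: encodesI => [|a /imfset2P[b _ [i _ ->]]|w /unit_codesP[b [i ->]]].
- by rewrite pnatr_eq0.
  exists (unit_code n (b, val i)); last exact: vec_unit.
  by apply/unit_codesP; exists b, i.
by exists (sgn R b *: unit_vec R i); [apply: in_imfset2|apply: vec_unit].
Qed.

Lemma encodes_pair n : encodes 2 (roots_pair R n) (pair_codes n).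
Proof.
have vec_pair b b' (i j : 'I_n) :
    2 *: (sgn R b *: unit_vec R i + sgn R b' *: unit_vec R j) =
    vec R n (addc (unit_code n (b, val i)) (unit_code n (b', val j))).
  by rewrite vec_addc ?size_mkseq // scalerDr !vec_unit.
have mem2 b b' : (b, b') \in
    [seq (b, b') | b <- [:: false; true], b' <- [:: false; true]].
  by case: b b' => [] [].
apply: encodesI => [|a /imfset2P[[b b'] _ [[i j] /= ij ->]]|w].
- by rewrite pnatr_eq0.
  rewrite inE in ij; rewrite vec_pair; eexists; last by [].
  apply/allpairsP; exists ((b, b'), (val i, val j)); split=> //=.
  rewrite mem_filter /= ij; apply/allpairsP.
  by exists (val i, val j); rewrite /= !mem_iota /= !add0n !ltn_ord.
move=> /allpairsP[[[b b'] [i j]] [_ /=]]; rewrite mem_filter /= => /andP[ij].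
move=> /allpairsP[[k l] [/= kn ln [e1 e2]]]; subst k l; move: kn ln.
rewrite !mem_iota /= !add0n => ilt jlt ->.
exists (sgn R b *: unit_vec R (Ordinal ilt) +
        sgn R b' *: unit_vec R (Ordinal jlt)).
  apply/imfset2P; exists (b, b') => //; exists (Ordinal ilt, Ordinal jlt) => //.
exact: vec_pair.
Qed.

Lemma mem_bools n s : (s \in bools n) = (size s == n).
Proof.
elim: n s => [|n IHn] [|b s] //.
  by apply/negbTE/negP => /allpairsP[[? ?] []].
rewrite [size _ == _]eqSS -IHn.
apply/allpairsP/idP => [[[b' t] [_ /= tn [_ ->]]]|sn] //.
by exists (b, s); split=> //; case: (b).
Qed.

Lemma vec_signed n (s : {ffun 'I_n -> bool}) c (a : 'rV[R]_n) u : size u = n ->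
  c *: a = vec R n u ->
  c *: sign_change s a = vec R n (signed [seq s i | i <- enum 'I_n] u).
Proof.
move=> su cau; apply/rowP => i; rewrite mxE mxE mulrCA.
have -> : c * a 0 i = vec R n u 0 i by rewrite -cau mxE.
rewrite !vecE (nth_map (false, (0, 0)%BZ)); last first.
  by rewrite size_zip size_map size_enum_ord su minnn.
rewrite nth_zip /=; last by rewrite size_map size_enum_ord su.
rewrite (nth_map i) ?size_enum_ord // nth_ord_enum; case: (s i);
  rewrite /sgn ?expr1 ?expr0 ?mul1r //.
by rewrite evN mulN1r.
Qed.

Lemma bools_ffun n t : size t = n ->
  t = [seq [ffun i : 'I_n => nth false t i] i | i <- enum 'I_n].
Proof.
move=> st; apply: (@eq_from_nth _ false) => [|k].
  by rewrite size_map size_enum_ord.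
rewrite st => kn; rewrite (nth_map (Ordinal kn)) ?size_enum_ord // ffunE.
by rewrite nth_enum_ord.
Qed.

Lemma encodes_signings n (c : R) (a : 'rV[R]_n) u : c != 0 -> size u = n ->
  c *: a = vec R n u ->
  encodes c [fset sign_change s a | s : {ffun 'I_n -> bool}] (signings u).
Proof.
move=> c0 su cau; apply: encodesI => // [_ /imfsetP[s _ ->]|w /mapP[t]].
  rewrite (vec_signed s su cau); eexists; last by [].
  by apply: map_f; rewrite mem_bools size_map size_enum_ord su.
rewrite mem_bools su => /eqP /bools_ffun -> ->.
set s := finfun _; exists (sign_change s a); first exact: in_imfset.
exact: vec_signed.
Qed.

Lemma vec_half n : 2 *: const_mx (1 / 2) = vec R n (half_code n).
Proof.
apply/rowP => i; rewrite vecE nth_nseq ltn_ord ev_int !mxE.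
by rewrite rmorph1 div1r mulfV ?pnatr_eq0.
Qed.

Lemma encodes_half n : encodes 2 (roots_half R n) (signings (half_code n)).
Proof.
by apply: encodes_signings (vec_half n); rewrite ?size_nseq ?pnatr_eq0.
Qed.

Lemma encodes_even_half n :
  encodes 2 [fset sign_change s (const_mx (1 / 2) : 'rV[R]_n)
              | s : {ffun 'I_n -> bool} & ~~ odd #|[set i | s i]|]
    [seq signed s (half_code n) | s <- bools n & ~~ odd (count id s)].
Proof.
have sn : size (half_code n) = n by rewrite size_nseq.
have cardE (s : {ffun 'I_n -> bool}) :
    #|[set i | s i]| = count id [seq s i | i <- enum 'I_n].
  by rewrite cardsE cardE count_map -size_filter enumT.
apply: encodesI => [|_ /imfsetP[s /= so ->]|w /mapP[t]].
- by rewrite pnatr_eq0.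
  rewrite (vec_signed s sn (vec_half n)); eexists; last by [].
  apply: map_f; rewrite mem_filter mem_bools size_map size_enum_ord eqxx andbT.
  by rewrite -cardE; rewrite inE in so.
rewrite mem_filter mem_bools => /andP[todd /eqP /bools_ffun tE] ->.
move: todd; rewrite tE; set s := finfun _ => sodd.
exists (sign_change s (const_mx (1 / 2))); last exact: vec_signed (vec_half n).
by apply: in_imfset; rewrite inE /= cardE.
Qed.

(** [col_perm p] puts entry [p i] at position [i], which is also how [tuple_permP] describes the
    rearrangements of a sequence. *)
Lemma encodes_permutations n (c : R) (a : 'rV[R]_n) u : c != 0 -> size u = n ->
  c *: a = vec R n u -> encodes c (permutations_of a) (permutations u).
Proof.
move=> c0 su cau; have vec_perm p :
    c *: col_perm p a = vec R n [seq nth (0, 0)%BZ u (p i) | i <- enum 'I_n].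
  apply/rowP => i; rewrite vecE (nth_map i) ?size_enum_ord // nth_ord_enum.
  by rewrite -vecE -cau !mxE.
have permsP t : reflect
    (exists p : 'S_n, t = [seq nth (0, 0)%BZ u (p i) | i <- enum 'I_n])
    (t \in permutations u).
  rewrite mem_permutations; have /eqP su' := su.
  have tE (p : 'S_n) : [tuple tnth (Tuple su') (p i) | i < n] =
      [seq nth (0, 0)%BZ u (p i) | i <- enum 'I_n] :> seq _.
    by apply: eq_map => i; rewrite (tnth_nth (0, 0)%BZ).
  by apply: (iffP (@tuple_permP _ _ t (Tuple su'))) => -[p ->]; exists p; rewrite ?tE.
apply: encodesI => // [_ /imfsetP[p _ ->]|w /permsP[p ->]].
  by rewrite vec_perm; eexists; [apply/permsP; exists p|].
by exists (col_perm p a); [apply: in_imfset|apply: vec_perm].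
Qed.

End Encodings.

(** * Even permutations of four coordinates *)

Section Reindexing.
Variable R : realType.

Lemma vec_reindex n (f : nat -> nat) (g : 'I_n -> 'I_n) (c : R)
    (a : 'rV[R]_n) u :
    size u = n -> c *: a = vec R n u -> (forall i, val (g i) = f (val i)) ->
  c *: \row_i a 0 (g i) = vec R n (reindex f u).
Proof.
move=> su cau gf; apply/rowP => i.
by rewrite vecE nth_mkseq ?su // -gf -vecE -cau !mxE.
Qed.

Lemma size_signed s u : size s = size u -> size (signed s u) = size u.
Proof. by move=> su; rewrite size_map size_zip su minnn. Qed.

Lemma size_signings u w : w \in signings u -> size w = size u.
Proof.
by move=> /mapP[s]; rewrite mem_bools => /eqP su ->; apply: size_signed.
Qed.

Lemma val_tperm n (i j x : 'I_n) : val (tperm i j x) = swap i j x.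
Proof.
rewrite /swap; case: tpermP => [->|->|/eqP xi /eqP xj]; rewrite ?eqxx //.
  by case: eqP => // ->.
by rewrite !val_eqE (negbTE xi) (negbTE xj).
Qed.

(** Sifting: transpositions are multiplied on the left of [p] to make it fix 0, then 1, then 2, each
    new one leaving the points already fixed alone. What remains is the identity, and [p] is the
    product of these transpositions. *)
Lemma perm4_swaps (p : 'S_4) : exists i j k : 'I_4,
  [/\ (1 <= j)%N, (2 <= k)%N
    & p = (tperm (inord 0) i * tperm (inord 1) j * tperm (inord 2) k)%g].
Proof.
pose o k : 'I_4 := inord k; have oE k : (k < 4)%N -> val (o k) = k.
  exact: inordK.
have o_inj k l : (k < 4)%N -> (l < 4)%N -> (o k == o l) = (k == l).
  by move=> k4 l4; rewrite -val_eqE !oE.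
pose i := (p^-1)%g (o 0%N); pose p1 := (tperm (o 0%N) i * p)%g.
have p10 : p1 (o 0%N) = o 0%N by rewrite permM tpermL permKV.
pose j := (p1^-1)%g (o 1%N); pose p2 := (tperm (o 1%N) j * p1)%g.
have p21 : p2 (o 1%N) = o 1%N by rewrite permM tpermL permKV.
have j0 : j != o 0%N by rewrite -(inj_eq (@perm_inj _ p1)) permKV p10 o_inj.
have p20 : p2 (o 0%N) = o 0%N by rewrite permM tpermD ?p10 // o_inj.
pose k := (p2^-1)%g (o 2%N); pose p3 := (tperm (o 2%N) k * p2)%g.
have p32 : p3 (o 2%N) = o 2%N by rewrite permM tpermL permKV.
have k0 : k != o 0%N by rewrite -(inj_eq (@perm_inj _ p2)) permKV p20 o_inj.
have k1 : k != o 1%N by rewrite -(inj_eq (@perm_inj _ p2)) permKV p21 o_inj.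
have p30 : p3 (o 0%N) = o 0%N by rewrite permM tpermD ?p20 // o_inj.
have p31 : p3 (o 1%N) = o 1%N by rewrite permM tpermD ?p21 // o_inj.
have o4 (x : 'I_4) : x = o (val x) by apply: val_inj; rewrite /= inordK.
have fix3 x : (val x < 3)%N -> p3 x = x.
  by move=> x3; rewrite (o4 x); case: (val x) x3 => [|[|[|]]].
have p3E : p3 = 1%g.
  apply/permP => x; rewrite perm1.
  have [x3|x3] := ltnP (val x) 3; first exact: fix3.
  (* The point 3 is fixed as well: if its image were below 3, that image would be fixed by [p3], and
     injectivity would make it equal to [x]. *)
  have [y3|y3] := ltnP (val (p3 x)) 3.
    by apply: (@perm_inj _ p3); apply: fix3.
  by apply: val_inj; have := ltn_ord x; have := ltn_ord (p3 x); move: x3 y3 => /=; lia.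
exists i, j, k; split.
- by have := j0; rewrite -val_eqE oE //= lt0n.
- by have := k0; have := k1; rewrite -!val_eqE !oE //=; lia.
have invol x y (q : 'S_4) : q = (tperm x y * (tperm x y * q))%g.
  by rewrite mulgA tperm2 mul1g.
rewrite {1}(invol (o 0%N) i p) -/p1 {1}(invol (o 1%N) j p1) -/p2.
by rewrite {1}(invol (o 2%N) k p2) -/p3 p3E mulg1 mulgA.
Qed.

(** A factor changes the sign exactly when its two points differ, which is what the filter in
    [even_swaps] counts. *)
Lemma tperms_swaps (i j k : 'I_4) (p := (tperm (inord 0) i * tperm (inord 1) j
                                         * tperm (inord 2) k)%g : 'S_4) :
  (forall x, val (p x) = swaps (val i, val j, val k) (val x)) /\
  odd_perm p = (val i != 0%N) (+) (val j != 1%N) (+) (val k != 2%N).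
Proof.
split=> [x|]; first by rewrite !permM !val_tperm /= !inordK.
rewrite /p !odd_permM !odd_tperm.
by rewrite -!val_eqE /= !inordK // ![in RHS](eq_sym (nat_of_ord _)).
Qed.

Lemma encodes_even_perms (c : R) (a : 'rV[R]_4) u : c != 0 -> size u = 4%N ->
  c *: a = vec R 4 u ->
  encodes c [fset col_perm p (sign_change s a)
              | s : {ffun 'I_4 -> bool}, p : 'S_4 & ~~ odd_perm p]
    [seq reindex (swaps t) w | w <- signings u, t <- even_swaps].
Proof.
move=> c0 su cau; have signsE := encodes_signings c0 su cau.
have vec_swaps (p : 'S_4) t b w : w \in signings u -> c *: b = vec R 4 w ->
    (forall x, val (p x) = swaps t (val x)) ->
    c *: col_perm p b = vec R 4 (reindex (swaps t) w).
  move=> wu cb pt; rewrite -(vec_reindex _ cb pt); last first.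
    by rewrite (size_signings wu).
  by congr (_ *: _); apply/rowP => i; rewrite !mxE.
apply: encodesI => // [_ /imfset2P[s _ [p pe ->]]|_ /allpairsP[[w t] [wu te ->]]].
  have : c *: sign_change s a \in [seq vec R 4 w | w <- signings u].
    by rewrite -signsE; apply: in_imfset.
  move=> /mapP[w wu cb]; have [i [j [k [j1 k2 pE]]]] := perm4_swaps p.
  have [pv podd] := tperms_swaps i j k; rewrite -pE in pv podd.
  exists (reindex (swaps (val i, val j, val k)) w); last exact: vec_swaps cb pv.
  apply/allpairsP; exists (w, (val i, val j, val k)); split=> //.
  rewrite mem_filter; apply/andP; split; first by rewrite inE in pe; rewrite -podd.
  apply/allpairsP; exists ((val i, val j), val k); split=> //.
    apply/allpairsP; exists (val i, val j).
    by split=> //; rewrite mem_iota ?j1 /= ltn_ord.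
  by rewrite mem_iota k2 /= ltn_ord.
rewrite /= in wu; move: te; rewrite mem_filter => /andP[todd /allpairsP].
move=> [[ij k] [/allpairsP[[i j] [i4 j4 ijE]] k4 tE]].
rewrite {}tE {}ijE in todd *; move: i4 j4 k4; rewrite !mem_iota.
move=> /= i4 /andP[j1 j4] /andP[k2 k4].
have : vec R 4 w \in [seq vec R 4 w | w <- signings u] by apply: map_f.
(* Conversely, dividing the vector of [w] by [c] recovers a sign change of [a]. *)
have := signsE (c^-1 *: vec R 4 w); rewrite scalerA divff // scale1r => <-.
move=> /imfsetP[s _ cw].
have cb : c *: sign_change s a = vec R 4 w by rewrite -cw scalerA divff // scale1r.
have [pv podd] := tperms_swaps (inord i) (inord j) (inord k).
set p := (_ * _)%g in pv podd.
rewrite /= !inordK // in pv podd.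
exists (col_perm p (sign_change s a)); last exact: vec_swaps cb pv.
by apply: in_imfset2 => //; rewrite inE podd.
Qed.
End Reindexing.

(** * Encodings of the six root systems *)

Section RootEncodings.
Variable R : realType.

Lemma encodes_cyclic (c : R) (a : 'rV[R]_3) u : c != 0 -> size u = 3%N ->
  c *: a = vec R 3 u ->
  encodes c [fset cyclic_shift k (sign_change s a)
              | s : {ffun 'I_3 -> bool}, k : 'I_3] (cyclic_codes u).
Proof.
move=> c0 su cau; have signsE := encodes_signings c0 su cau.
have vec_shift (k : 'I_3) b w : w \in signings u -> c *: b = vec R 3 w ->
    c *: cyclic_shift k b = vec R 3 (reindex (fun i => (i + k) %% 3)%N w).
  move=> wu cb; apply: (vec_reindex (g := fun i => i + k) _ cb) => //.
  by rewrite (size_signings wu).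
apply: encodesI => // [_ /imfset2P[s _ [k _ ->]]|_ /allpairsP[[w k] [wu k3 ->]]].
  have : c *: sign_change s a \in [seq vec R 3 w | w <- signings u].
    by rewrite -signsE; apply: in_imfset.
  move=> /mapP[w wu cb]; eexists; last exact: vec_shift wu cb.
  by apply/allpairsP; exists (w, val k); split=> //; rewrite mem_iota /= ltn_ord.
move: wu k3; rewrite mem_iota /= => wu k3.
have : vec R 3 w \in [seq vec R 3 w | w <- signings u] by apply: map_f.
have := signsE (c^-1 *: vec R 3 w); rewrite scalerA divff // scale1r => <-.
move=> /imfsetP[s _ cw].
have cb : c *: sign_change s a = vec R 3 w by rewrite -cw scalerA divff // scale1r.
exists (cyclic_shift (Ordinal k3) (sign_change s a)); first exact: in_imfset2.
exact: vec_shift wu cb.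
Qed.

Lemma encodes1 n (c : R) (a : 'rV[R]_n) u : c != 0 -> c *: a = vec R n u ->
  encodes c [fset a] [:: u].
Proof.
by move=> c0 cau b; rewrite !inE -cau; apply/eqP/eqP => [->|/(scalerI c0)].
Qed.

Lemma encodes_imfset m n (c : R) (f : 'rV[R]_m -> 'rV[R]_n) g Phi W : c != 0 ->
    encodes c Phi W ->
    (forall a u, u \in W -> c *: a = vec R m u -> c *: f a = vec R n (g u)) ->
  encodes c [fset f a | a in Phi] (map g W).
Proof.
move=> c0 PW fg; apply: encodesI => // [_ /imfsetP[a aP ->]|_ /mapP[u uW ->]].
  have : c *: a \in [seq vec R m w | w <- W] by rewrite -PW.
  by move=> /mapP[u uW au]; exists (g u); [apply: map_f|apply: fg].
have cu : c *: (c^-1 *: vec R m u) = vec R m u by rewrite scalerA divff // scale1r.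
exists (f (c^-1 *: vec R m u)); last exact: fg.
by apply: in_imfset; rewrite PW cu map_f.
Qed.

Lemma row_of_scale n (c : R) s : c *: row_of n s = row_of n (map ( *%R c) s).
Proof.
apply/rowP => i; rewrite !mxE; have [lt_i|le_i] := ltnP i (size s).
  by rewrite (nth_map 0).
by rewrite !nth_default ?size_map // mulr0.
Qed.

Lemma vec_cat m n u v : size u = m ->
  vec R (m + n) (u ++ v) = row_mx (vec R m u) (vec R n v).
Proof.
move=> su; apply/rowP => i; case: (splitP i) => j ij.
  have -> : i = lshift n j by apply: val_inj.
  by rewrite row_mxEl !vecE nth_cat su /= ltn_ord.
have -> : i = rshift m j by apply: val_inj.
by rewrite row_mxEr !vecE nth_cat su /= ltnNge leq_addr addKn.
Qed.

Lemma vec_triple (c : R) (x y z : 'rV[R]_3) u v w :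
    size u = 3%N -> size v = 3%N -> c *: x = vec R 3 u -> c *: y = vec R 3 v ->
    c *: z = vec R 3 w ->
  c *: triple x y z = vec R (3 + (3 + 3)) (u ++ v ++ w).
Proof.
by move=> su sv cx cy cz; rewrite vec_cat // vec_cat // !scale_row_mx cx cy cz.
Qed.

Let two_neq0 : 2 != 0 :> R. Proof. by rewrite pnatr_eq0. Qed.
Let three_neq0 : 3 != 0 :> R. Proof. by rewrite pnatr_eq0. Qed.

Lemma tau_inv : (tau R)^-1 = tau R - 1.
Proof.
have t0 : tau R != 0 by rewrite mulf_neq0 ?invr_eq0 // gt_eqF // ltr_wpDr ?sqrtr_ge0.
by apply: (mulfI t0); rewrite divff // mulrBr tau_sqr mulr1 addrC addKr.
Qed.

Lemma encodes_F4 : encodes 2 (F4 R) F4_codes.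
Proof.
rewrite /F4_codes catA.
apply: encodesU; last exact: encodes_half.
apply: encodesU; [exact: encodes_unit|exact: encodes_pair].
Qed.

Lemma encodes_E8 : encodes 2 (E8 R) E8_codes.
Proof. by apply: encodesU; [apply: encodes_pair|apply: encodes_even_half]. Qed.

Let ev1 : ev R (1, 0)%BZ = 1.
Proof. by rewrite ev_int. Qed.

Let evtau : ev R (0, 1)%BZ = tau R.
Proof. by rewrite /ev add0r mul1r. Qed.

Let evtau_inv : ev R (-1, 1)%BZ = (tau R)^-1.
Proof.
by rewrite tau_inv -evtau -ev1 -evN -evD.
Qed.

Lemma encodes_E7 : encodes 2 (E7 R) E7_codes.
Proof.
apply: encodesU; apply: encodes_permutations => //.
  rewrite row_of_scale; congr (row_of 8 _); rewrite /= !ev_int /=.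
  by rewrite NegzE mulr1 mulr0 mulrN1 rmorphN.
rewrite row_of_scale row_of_scale; congr (row_of 8 _); rewrite /= !ev_int /=.
by rewrite NegzE rmorphN !mulrN !mulr1 div1r divff.
Qed.

Lemma encodes_H4 : encodes 2 (H4 R) H4_codes.
Proof.
rewrite /H4_codes catA.
apply: encodesU.
  by apply: encodesU; [apply: encodes_unit|apply: encodes_half].
apply: encodes_even_perms => //; rewrite row_of_scale row_of_scale.
congr (row_of 4 _); rewrite /= evtau evtau_inv ev1 ev0.
by rewrite !mulrA mulr1 divff // !mul1r.
Qed.

Lemma encodes_H3 : encodes 1 (H3 R) H3_codes.
Proof.
apply: encodesU; apply: encodes_cyclic; rewrite ?oner_eq0 ?scale1r //.
  by congr (row_of 3 _); rewrite /= ev1 ev0.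
by congr (row_of 3 _); rewrite /= evtau evtau_inv ev1.
Qed.

Lemma encodes_xi : encodes 3 (A2_positive_roots R) xi_codes.
Proof.
(* An explicit finite set is a left-nested union of singletons, so the list is split in the same
   way. *)
apply: (encodesU (W := [:: _; _]) (X := [:: _])).
  apply: (encodesU (W := [:: _]) (X := [:: _])).
    apply: encodes1 => //; rewrite row_of_scale; congr (row_of 3 _).
    by rewrite /= !ev_int /= NegzE rmorphN mulr1 mulrN1 mulr0.
  apply: encodes1 => //; rewrite row_of_scale; congr (row_of 3 _).
  by rewrite /= !ev_int /= NegzE rmorphN mulr1 mulrN1 mulr0.
apply: encodes1 => //; rewrite row_of_scale; congr (row_of 3 _).
by rewrite /= !ev_int /= NegzE rmorphN mulr1 mulrN1 mulr0.
Qed.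

Lemma encodes_omega : encodes 3 (A2_weights R) omega_codes.
Proof.
have third (s : seq R) : 3 *: ((1 / 3) *: row_of 3 s) = row_of 3 s.
  by rewrite scalerA mulrA mulr1 divff // scale1r.
apply: (encodesU (W := [:: _; _]) (X := [:: _])).
  apply: (encodesU (W := [:: _]) (X := [:: _])).
    by apply: encodes1 => //; rewrite third; congr (row_of 3 _); rewrite /= !ev_int.
  by apply: encodes1 => //; rewrite third; congr (row_of 3 _); rewrite /= !ev_int.
by apply: encodes1 => //; rewrite third; congr (row_of 3 _); rewrite /= !ev_int.
Qed.

Lemma encodes_E6_reps : encodes 3 (E6_reps R) E6_rep_codes.
Proof.
have zero : 3 *: (0 : 'rV[R]_3) = vec R 3 zero3.
  by rewrite scaler0; apply/rowP => -[[|[|[|]]] // ?]; rewrite vecE mxE ev0.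
have size_xi u : u \in xi_codes -> size u = 3%N.
  by rewrite !inE => /or3P[] /eqP ->.
have size_omega u : u \in omega_codes -> size u = 3%N.
  by rewrite !inE => /or3P[] /eqP ->.
apply: encodesU; [apply: encodesU; [apply: encodesU|]|].
- apply: encodes_imfset encodes_xi _ => // x u /size_xi su xu.
  exact: vec_triple.
- apply: encodes_imfset encodes_xi _ => // x u /size_xi su xu.
  exact: vec_triple.
- apply: encodes_imfset encodes_xi _ => // x u /size_xi su xu.
  exact: vec_triple.
apply: encodesI => // [_ /imfset2P[x xw [[y z] yzw ->]]|u0 /allpairsP[[u vw] [uW]]].
  move: yzw; rewrite inE => /andP[yw zw]; rewrite /= in yw zw.
  move: xw yw zw; rewrite !encodes_omega.
  move=> /mapP[u uW xu] /mapP[v vW yv] /mapP[w wW zw].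
  exists (u ++ (v ++ w)); last by apply: vec_triple => //; apply: size_omega.
  apply/allpairsP; exists (u, v ++ w); split=> //.
  by apply/allpairsP; exists (v, w).
move=> /allpairsP[[v w] [vW wW /= ->]] ->; rewrite /= in uW vW wW.
have third s : 3 *: (3^-1 *: vec R 3 s) = vec R 3 s by rewrite scalerA divff // scale1r.
have weight s : s \in omega_codes -> 3^-1 *: vec R 3 s \in A2_weights R.
  by move=> sW; rewrite encodes_omega third map_f.
exists (triple (3^-1 *: vec R 3 u) (3^-1 *: vec R 3 v) (3^-1 *: vec R 3 w)).
  apply/imfset2P; exists (3^-1 *: vec R 3 u); first exact: weight.
  exists (3^-1 *: vec R 3 v, 3^-1 *: vec R 3 w) => //.
  by rewrite /= inE /= !weight.
by apply: vec_triple => //; apply: size_omega.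
Qed.

Lemma encodes_E6 : encodes 3 (E6 R) E6_codes.
Proof.
by apply: encodesU; [|apply: encodes_opp]; apply: encodes_E6_reps.
Qed.

End RootEncodings.

(** * From codes to root configurations *)

Section RootConfigurations.
Variables (R : realType) (n : nat) (c : R) (Phi : {fset 'rV[R]_n}).
Variable W : seq code.
Hypotheses (c0 : c != 0) (PhiW : encodes c Phi W).

Lemma half_sub (X : seq code) : {subset half X <= X}.
Proof.
elim: X => //= u X IHX w; case: ifP => _; rewrite !inE.
  by move=> /IHX ->; rewrite orbT.
by case/orP=> [->//|/IHX ->]; rewrite orbT.
Qed.

(** Together with [half_sub], this shows that passing to [half] preserves the set of lines. *)
Lemma half_cover (X : seq code) u :
  u \in X -> (u \in half X) || (oppc u \in half X).
Proof.
elim: X => //= w X IHX; rewrite inE => /predU1P[->|/IHX].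
  by case: ifP => //; rewrite inE eqxx.
by case: ifP => // _; rewrite !inE => /orP[] ->; rewrite ?orbT.
Qed.

Lemma vline_scale (K : fieldType) (vT : vectType K) (a : K) (v : vT) :
  a != 0 -> <[a *: v]>%VS = <[v]>%VS.
Proof.
move=> a0; apply/eqP; rewrite eqEsubv -!memvE rpredZ ?memv_line //=.
by rewrite -[X in X \in _]scale1r -(mulVf a0) -scalerA rpredZ ?memv_line.
Qed.

Lemma vline_oppc u : <[vec R n (oppc u)]>%VS = <[vec R n u]>%VS.
Proof. by rewrite vec_oppc -scaleN1r vline_scale // oppr_eq0 oner_eq0. Qed.

Lemma root_lines_codes : root_lines Phi = lines_of R n (half W).
Proof.
apply/fsetP => K; apply/imfsetP/imfsetP => /= [[a]|[u /half_sub uW ->]].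
  rewrite PhiW => /mapP[u /half_cover uW au] ->.
  rewrite -(vline_scale a c0) au; case/orP: uW => uW.
    by exists u.
  by exists (oppc u); rewrite ?vline_oppc.
exists (c^-1 *: vec R n u); last by rewrite vline_scale ?invr_eq0.
by rewrite PhiW scalerA divff // scale1r map_f.
Qed.

Lemma vec_root_space u : u \in W -> vec R n u \in root_space Phi.
Proof.
move=> uW; rewrite -[vec R n u]scale1r -(divff c0) -scalerA.
apply/rpredZ/memv_span.
by rewrite -[_ \in _]/(_ \in Phi) PhiW scalerA divff // scale1r map_f.
Qed.

(* X and the sums of the pairs in P span an orthogonal basis of the root
   space, and Y one of its orthogonal complement. *)
Definition dimension_check (X : seq code) (P : seq (code * code))
    (Y : seq code) : bool :=
  let B := X ++ [seq addc p.1 p.2 | p <- P] in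
  [&& [&& all (fun u => size u == n) W, all (mem W) X
        & all (fun p => (p.1 \in W) && (p.2 \in W)) P],
      [&& valid_codes n B, pairwise orth B, valid_codes n Y & pairwise orth Y],
      all (fun u => all (orth u) Y) W & (size B + size Y == n)%N].

Variables (X : seq code) (P : seq (code * code)) (Y : seq code).
Hypothesis dimXPY : dimension_check X P Y.

Let orthogonal_codes (B : seq code) :
  valid_codes n B -> pairwise orth B -> orthogonal [seq vec R n u | u <- B].
Proof.
move=> /allP valB pB; apply/andP; split.
  rewrite pairwise_map.
  apply: (sub_in_pairwise (P := mem B)) (allss B) pB => u v uB vB /= uv.
  have [/eqP su _] := andP (valB u uB); have [/eqP sv _] := andP (valB v vB).
  by rewrite dotp_vec_eq0.
apply/negP => /mapP[u uB u0]; have [/eqP su] := andP (valB u uB).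
by rewrite -(@dotp_vec_eq0 R n) // -u0 dotp0 eqxx.
Qed.

Let B := X ++ [seq addc p.1 p.2 | p <- P].

Let subB : {subset [seq vec R n u | u <- B] <= root_space Phi}.
Proof.
case/and4P: dimXPY => /and3P[/allP sW /allP XW /allP PW] _ _ _.
move=> _ /mapP[u uB ->].
move: uB; rewrite mem_cat => /orP[/XW uW|/mapP[p /PW/andP[p1 p2] ->]].
  exact: vec_root_space.
rewrite vec_addc ?(eqP (sW _ _)) //.
by rewrite rpredD // vec_root_space.
Qed.

Let orthY : {in root_space Phi & [seq vec R n u | u <- Y],
  forall v y, dotp v y = 0}.
Proof.
case/and4P: dimXPY => /and3P[/allP sW _ _] /and4P[_ _ /allP valY _] /allP WY _.
move=> v _ vPhi /mapP[y yY ->]; apply: dotp_span vPhi => a aPhi.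
have : c *: a \in [seq vec R n u | u <- W] by rewrite -PhiW.
move=> /mapP[u uW au]; apply: (mulfI c0); rewrite mulr0 -dotpZl au; apply/eqP.
have [/eqP sy _] := andP (valY y yY).
by rewrite dotp_vec_eq0 ?(eqP (sW u uW)) // (allP (WY u uW)).
Qed.

(** The complement criterion applies with [B] inside the root space and [Y] orthogonal to every
    root, hence to their span. *)
Lemma dim_root_space : \dim (root_space Phi) = (size X + size P)%N.
Proof.
have /and4P[_ /and4P[valB pB valY pY] _ /eqP sBY] := dimXPY.
have := dim_complement subB (orthogonal_codes valB pB)
  (orthogonal_codes valY pY) orthY.
by rewrite !size_map size_cat size_map; apply; rewrite -sBY size_cat size_map.
Qed.

Lemma mem_root_space u : size u = n -> all (orth u) Y ->
  vec R n u \in root_space Phi.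
Proof.
have /and4P[_ /and4P[valB pB valY pY] _ /eqP sBY] := dimXPY.
move=> su /allP uY.
apply: (memv_complement subB (orthogonal_codes valB pB)
  (orthogonal_codes valY pY) orthY).
  by rewrite !size_map.
move=> _ /mapP[y yY ->]; apply/eqP.
have [/eqP sy _] := andP (allP valY y yY).
by rewrite dotp_vec_eq0 // uY.
Qed.

(** The lines of [L] serve as the extension: orthogonality to [Y] puts them in the root space, and
    each root has its code, up to sign, in [L]. *)
Lemma noncolourable_extension L fs :
    saturation_check n (size X + size P) L ->
    refutation_check n (size X + size P) L fs ->
    {in L, forall u, all (orth u) Y} ->
    {in half W, forall u, (u \in L) || (oppc u \in L)} ->
  exists A : {fset {vspace 'rV[R]_n}},
    [/\ projective_configuration (root_space Phi) A, root_lines Phi `<=` A,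
        saturated (root_space Phi) A & ~ colourable (root_space Phi) A].
Proof.
rewrite -dim_root_space => satL refL LY WL; exists (lines_of R n L); split.
- move=> _ /imfsetP[u /= uL ->]; have [su uu] := saturation_valid satL uL.
  split; last by rewrite dim_vline -dotp_eq0 dotp_vec_eq0 // uu.
  by rewrite -memvE; apply: mem_root_space su (LY u uL).
- rewrite root_lines_codes; apply/fsubsetP => _ /imfsetP[u /= uW ->].
  have /orP[uL|uL] := WL u uW; first exact: in_imfset.
  by rewrite -vline_oppc; apply: in_imfset.
- exact: saturated_lines.
- exact: not_colourable_lines refL.
Qed.

End RootConfigurations.
(** * Certificates *)

(* The numbers are 1-based positions in the lists half F4_codes, etc., and
   E6_extension. *)
Definition F4_frames : seq (seq positive) :=
  [:: [:: 17; 20; 22; 23];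
      [:: 7; 8; 13; 14];
      [:: 3; 4; 5; 11];
      [:: 6; 9; 12; 15];
      [:: 18; 19; 21; 24];
      [:: 1; 2; 10; 16]]%positive.

Definition E7_frames : seq (seq positive) :=
  [:: [:: 10; 13; 18; 28; 50; 55; 62];
      [:: 30; 35; 42; 48; 51; 55; 61];
      [:: 9; 15; 19; 28; 52; 56; 61];
      [:: 5; 9; 18; 23; 36; 44; 51];
      [:: 2; 14; 20; 22; 33; 37; 59];
      [:: 6; 14; 16; 25; 39; 47; 60];
      [:: 3; 9; 14; 24; 29; 43; 55]]%positive.

Definition E8_frames : seq (seq positive) :=
  [:: [:: 7; 20; 36; 52; 74; 87; 93; 100];
      [:: 33; 38; 45; 50; 62; 85; 98; 105];
      [:: 4; 11; 14; 28; 32; 39; 42; 56];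
      [:: 3; 27; 40; 43; 72; 82; 101; 115];
      [:: 60; 69; 78; 83; 89; 104; 111; 114]]%positive.

Definition H4_frames : seq (seq positive) :=
  [:: [:: 6; 29; 38; 59];
      [:: 23; 25; 45; 52];
      [:: 2; 21; 36; 50];
      [:: 5; 40; 44; 48];
      [:: 10; 15; 30; 57];
      [:: 20; 30; 46; 50];
      [:: 3; 39; 40; 46];
      [:: 3; 15; 34; 52];
      [:: 20; 34; 38; 54];
      [:: 24; 29; 39; 55];
      [:: 22; 26; 44; 54];
      [:: 2; 24; 26; 57];
      [:: 10; 22; 25; 55]]%positive.

Definition E6_frames : seq (seq positive) :=
  [:: [:: 3; 6; 48; 75; 102; 154];
      [:: 27; 33; 48; 75; 154; 205];
      [:: 24; 26; 32; 36; 48; 154];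
      [:: 21; 23; 29; 33; 101; 156];
      [:: 22; 26; 32; 34; 102; 154];
      [:: 79; 102; 106; 154; 200; 227];
      [:: 7; 12; 102; 154; 205; 232];
      [:: 23; 31; 102; 119; 154; 189];
      [:: 25; 35; 92; 102; 154; 216];
      [:: 81; 101; 108; 156; 199; 226];
      [:: 3; 5; 8; 37; 41; 42];
      [:: 20; 24; 101; 118; 156; 215];
      [:: 30; 32; 91; 101; 156; 188];
      [:: 3; 4; 9; 16; 101; 156];
      [:: 6; 19; 73; 155; 204; 231];
      [:: 15; 17; 73; 100; 155; 206];
      [:: 73; 84; 111; 155; 196; 223];
      [:: 14; 18; 33; 35; 73; 155];
      [:: 2; 9; 73; 77; 104; 155]]%positive.

(** Each of the 15 lines of [H3] is orthogonal to exactly two others, so the graph consists of five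
    disjoint triangles. One vertex is taken from each. *)
Definition H3_ones : seq positive := [:: 1; 4; 5; 6; 7]%positive.

Definition unit_frame (n : nat) : seq code :=
  [seq unit_code n (false, i) | i <- iota 0 n].

Definition E8_basis : seq code :=
  flatten [seq [seq addc (unit_code 8 (false, i)) (unit_code 8 (b, i.+1))
                 | b <- [:: false; true]] | i <- [:: 0; 2; 4; 6]%N].

Definition E7_basis : seq code :=
  map zcode
    [:: [:: 2; -2; 0; 0; 0; 0; 0; 0]; [:: 0; 0; 2; -2; 0; 0; 0; 0];
        [:: 0; 0; 0; 0; 2; -2; 0; 0]; [:: 0; 0; 0; 0; 0; 0; 2; -2];
        [:: 1; 1; -1; -1; 1; 1; -1; -1]; [:: 1; 1; -1; -1; -1; -1; 1; 1];
        [:: 1; 1; 1; 1; -1; -1; -1; -1]]%BZ.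

Definition H3_basis : seq code :=
  map zcode [:: [:: 1; 0; 0]; [:: 0; 1; 0]; [:: 0; 0; 1]]%BZ.

Definition in_block (x : code) : seq code :=
  [:: x ++ zero3 ++ zero3; zero3 ++ x ++ zero3; zero3 ++ zero3 ++ x].

Definition E6_basis : seq code := in_block (zcode [:: 3; -3; 0]%BZ).

(** The plane of an A2 block contains no two orthogonal roots. The root [(1, -1, 0)] is therefore
    completed by [(1, 1, -2)], the sum of the two other positive roots. *)
Definition E6_pairs : seq (code * code) :=
  zip (in_block (zcode [:: 3; 0; -3]%BZ)) (in_block (zcode [:: 0; 3; -3]%BZ)).

Definition E6_normals : seq code := in_block (zcode [:: 1; 1; 1]%BZ).

(** * Evaluation of the checks *)

Lemma F4_dimension :
  dimension_check 4 F4_codes (unit_frame 4) [::] [::].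
Proof. by vm_compute. Qed.

Lemma E7_dimension :
  dimension_check 8 E7_codes E7_basis [::] [:: half_code 8].
Proof. by vm_compute. Qed.

Lemma E8_dimension :
  dimension_check 8 E8_codes E8_basis [::] [::].
Proof. by vm_compute. Qed.

Lemma H4_dimension :
  dimension_check 4 H4_codes (unit_frame 4) [::] [::].
Proof. by vm_compute. Qed.

Lemma H3_dimension :
  dimension_check 3 H3_codes H3_basis [::] [::].
Proof. by vm_compute. Qed.

Lemma E6_dimension :
  dimension_check (3 + (3 + 3)) E6_codes E6_basis E6_pairs E6_normals.
Proof. by vm_compute. Qed.

Lemma F4_saturation :
  saturation_check 4 4 (half F4_codes).
Proof. by vm_compute. Qed.

Lemma F4_refutation :
  refutation_check 4 4 (half F4_codes) F4_frames.
Proof. by vm_compute. Qed.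

Lemma E7_saturation :
  saturation_check 8 7 (half E7_codes).
Proof. by vm_compute. Qed.

Lemma E7_refutation :
  refutation_check 8 7 (half E7_codes) E7_frames.
Proof. by vm_compute. Qed.

Lemma E8_saturation :
  saturation_check 8 8 (half E8_codes).
Proof. by vm_compute. Qed.

Lemma E8_refutation :
  refutation_check 8 8 (half E8_codes) E8_frames.
Proof. by vm_compute. Qed.

Lemma H4_saturation :
  saturation_check 4 4 (half H4_codes).
Proof. by vm_compute. Qed.

Lemma H4_refutation :
  refutation_check 4 4 (half H4_codes) H4_frames.
Proof. by vm_compute. Qed.

Lemma H3_saturation :
  saturation_check 3 3 (half H3_codes).
Proof. by vm_compute. Qed.

Lemma H3_colouring :
  colouring_check 3 3 (half H3_codes) H3_ones.
Proof. by vm_compute. Qed.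

Lemma E6_extension_saturation :
  saturation_check (3 + (3 + 3)) 6 E6_extension.
Proof. by vm_compute. Qed.

Lemma E6_extension_refutation :
  refutation_check (3 + (3 + 3)) 6 E6_extension E6_frames.
Proof. by vm_compute. Qed.

Lemma E6_extension_normals :
  {in E6_extension, forall u, all (orth u) E6_normals}.
Proof. by apply/allP; vm_compute. Qed.

Lemma E6_extension_roots :
  {in half E6_codes, forall u,
    (u \in E6_extension) || (oppc u \in E6_extension)}.
Proof. by apply/allP; vm_compute. Qed.

Theorem theorem1 (R : realType) :
  [/\ [/\ \dim (root_space (F4 R)) = 4%N, \dim (root_space (E7 R)) = 7%N &
          \dim (root_space (E8 R)) = 8%N] /\
      [/\ \dim (root_space (H4 R)) = 4%N, \dim (root_space (H3 R)) = 3%N &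
          \dim (root_space (E6 R)) = 6%N],
      [/\ saturated (root_space (F4 R)) (root_lines (F4 R)) /\
            ~ colourable (root_space (F4 R)) (root_lines (F4 R)),
          saturated (root_space (E7 R)) (root_lines (E7 R)) /\
            ~ colourable (root_space (E7 R)) (root_lines (E7 R)),
          saturated (root_space (E8 R)) (root_lines (E8 R)) /\
            ~ colourable (root_space (E8 R)) (root_lines (E8 R)) &
          saturated (root_space (H4 R)) (root_lines (H4 R)) /\
            ~ colourable (root_space (H4 R)) (root_lines (H4 R))],
      saturated (root_space (H3 R)) (root_lines (H3 R)) /\
        colourable (root_space (H3 R)) (root_lines (H3 R)) &
      exists B : {fset {vspace 'rV[R]_(3 + (3 + 3))}},
        [/\ projective_configuration (root_space (E6 R)) B,
            root_lines (E6 R) `<=` B,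
            saturated (root_space (E6 R)) B &
            ~ colourable (root_space (E6 R)) B]].
Proof.
have two0 : 2 != 0 :> R by rewrite pnatr_eq0.
have three0 : 3 != 0 :> R by rewrite pnatr_eq0.
have one0 : 1 != 0 :> R by rewrite oner_eq0.
(* Saturation and colourability are stated with [\dim], whereas the checks were evaluated at
   numerals; these equations link the two. *)
have dF4 : \dim (root_space (F4 R)) = 4%N.
  by rewrite (dim_root_space two0 (@encodes_F4 R) F4_dimension).
have dE7 : \dim (root_space (E7 R)) = 7%N.
  by rewrite (dim_root_space two0 (@encodes_E7 R) E7_dimension).
have dE8 : \dim (root_space (E8 R)) = 8%N.
  by rewrite (dim_root_space two0 (@encodes_E8 R) E8_dimension).
have dH4 : \dim (root_space (H4 R)) = 4%N.
  by rewrite (dim_root_space two0 (@encodes_H4 R) H4_dimension).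
have dH3 : \dim (root_space (H3 R)) = 3%N.
  by rewrite (dim_root_space one0 (@encodes_H3 R) H3_dimension).
have dE6 : \dim (root_space (E6 R)) = 6%N.
  by rewrite (dim_root_space three0 (@encodes_E6 R) E6_dimension).
split; first by split; split.
- rewrite (root_lines_codes two0 (@encodes_F4 R)).
  rewrite (root_lines_codes two0 (@encodes_E7 R)).
  rewrite (root_lines_codes two0 (@encodes_E8 R)).
  rewrite (root_lines_codes two0 (@encodes_H4 R)).
  split; (split; [apply: saturated_lines|apply: not_colourable_lines]).
  + by rewrite dF4; apply: F4_saturation.
  + by rewrite dF4; apply: F4_refutation.
  + by rewrite dE7; apply: E7_saturation.
  + by rewrite dE7; apply: E7_refutation.
  + by rewrite dE8; apply: E8_saturation.
  + by rewrite dE8; apply: E8_refutation.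
  + by rewrite dH4; apply: H4_saturation.
  + by rewrite dH4; apply: H4_refutation.
- rewrite (root_lines_codes one0 (@encodes_H3 R)).
  split; [apply: saturated_lines|apply: colourable_lines]; rewrite dH3.
    exact: H3_saturation.
  exact: H3_colouring.
exact: (noncolourable_extension three0 (@encodes_E6 R) E6_dimension
  E6_extension_saturation E6_extension_refutation E6_extension_normals
  E6_extension_roots).
Qed.
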